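(* Suppose there are $\varepsilon_0\in(0,1]$ and $\sigma>0$ such that, for every $0<\varepsilon\le\varepsilon_0$, all $p_1,p_2\in P_\varepsilon\mathcal H$ and all $q\in Q_\varepsilon\mathcal H$, $$\bigl\langle A(p_1-p_2)-P_\varepsilon\bigl(F(p_1+q)-F(p_2+q)\bigr),\,p_1-p_2\bigr\rangle_{\mathcal H}\ge\sigma\|p_1-p_2\|_{\mathcal H}^2 .$$ Let $0<\varepsilon\le\varepsilon_0$ with $\gamma_\varepsilon\ge8L$. Then, for every $u_0\in\mathcal H$, $$\sup_{t\ge0}\|R_\varepsilon S(t)u_0-S_\varepsilon^{\mathcal M}(t)R_\varepsilon u_0\|_{\mathcal H}\le c_\varepsilon\left[\frac{L}{\lambda_\varepsilon^+}\|Q_\varepsilon u_0\|_{\mathcal H}+\frac{L}{\sigma}d_\varepsilon\right].$$ Consequently, for every bounded $B\subset\mathcal H$ there is a constant $C_B$, independent of $\varepsilon$, such that $$\sup_{u_0\in B}\ \sup_{t\ge0}\|R_\varepsilon S(t)u_0-S_\varepsilon^{\mathcal M}(t)R_\varepsilon u_0\|_{\mathcal H}\le C_B\,\varepsilon^2.$$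
   Context: $\mathcal H$ is an infinite-dimensional real Hilbert space and $A:\mathrm D(A)\subset\mathcal H\to\mathcal H$ is a nonnegative self-adjoint operator with compact resolvent. The map $F:\mathcal H\to\mathcal H$ satisfies, for constants $M,L>0$, $\|F(u)\|_{\mathcal H}\le M$ and $\|F(u)-F(w)\|_{\mathcal H}\le L\|u-w\|_{\mathcal H}$ for all $u,w\in\mathcal H$. Fix $\mu>0$. For $0<\varepsilon\le1$ let $\Lambda_\varepsilon=\mu\varepsilon^{-2}$, $P_\varepsilon=\mathbf 1_{[0,\Lambda_\varepsilon]}(A)$, $Q_\varepsilon=I-P_\varepsilon$, $A_\varepsilon=A+\varepsilon^{-1}Q_\varepsilon$ with $\mathrm D(A_\varepsilon)=\mathrm D(A)$. Put $\beta_\varepsilon=\sup\sigma(A|_{P_\varepsilon\mathcal H})$ ($=0$ if $P_\varepsilon\mathcal H=\{0\}$), $\lambda_\varepsilon^+=\inf\sigma(A|_{Q_\varepsilon\mathcal H})$, $\alpha_\varepsilon=\lambda_\varepsilon^++\varepsilon^{-1}$, $\gamma_\varepsilon=\alpha_\varepsilon-\beta_\varepsilon$. $S(t)$ and $S_\varepsilon(t)$ are the semiflows on $\mathcal H$ of global mild solutions of $\dot v+Av=F(v)$ and $\dot v^\varepsilon+A_\varepsilon v^\varepsilon=F(v^\varepsilon)$, respectively. Whenever $\gamma_\varepsilon\ge8L$, $\mathcal M_\varepsilon=\{p+h_\varepsilon(p):p\in P_\varepsilon\mathcal H\}$ denotes the inertial manifold of $S_\varepsilon(t)$ given by classical theory,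 with $h_\varepsilon:P_\varepsilon\mathcal H\to Q_\varepsilon\mathcal H$, $\|h_\varepsilon\|_{L^\infty}\le M/\alpha_\varepsilon$, $\operatorname{Lip}(h_\varepsilon)\le4L/\gamma_\varepsilon$, $S_\varepsilon(t)\mathcal M_\varepsilon=\mathcal M_\varepsilon$ for $t\ge0$, and dynamics on $\mathcal M_\varepsilon$ governed by $\dot p+Ap=P_\varepsilon F(p+h_\varepsilon(p))$ for $p\in P_\varepsilon\mathcal H$. Write $S_\varepsilon^{\mathcal M}(t)=S_\varepsilon(t)|_{\mathcal M_\varepsilon}$ and define $R_\varepsilon:\mathcal H\to\mathcal M_\varepsilon$, $R_\varepsilon u=P_\varepsilon u+h_\varepsilon(P_\varepsilon u)$. Finally $c_\varepsilon=\sqrt{1+16L^2/\gamma_\varepsilon^2}$ and $d_\varepsilon=M/\lambda_\varepsilon^++M/\alpha_\varepsilon$. *)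

(* Defs.v *)
From HB Require Import structures.
From mathcomp Require Import all_boot all_order all_algebra.
From mathcomp Require Import all_classical all_reals all_analysis.

Set Implicit Arguments.
Unset Strict Implicit.
Unset Printing Implicit Defensive.

Import Order.TTheory GRing.Theory Num.Theory.
Import numFieldNormedType.Exports.

Local Open Scope classical_set_scope.
Local Open Scope ring_scope.

(* Conventions.
   - A real Hilbert space is a complete normed module [H] over [R : realType]
     with [dot : {dot H for idfun}] (a positive definite symmetric bilinear
     form) such that [hilbert_norm dot] holds.
   - Functions of time have type [R -> _]; only their values at [0 <= t]
     matter. *)

Definition hilbert_norm {R : realType} {H : completeNormedModType R}
    (dot : {dot H for idfun}) : Prop :=
  forall x : H, `|x| ^+ 2 = dot x x.

Definition infinite_dimensional {R : realType} (H : completeNormedModType R) :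
    Prop :=
  ~ exists (n : nat) (e : 'I_n -> H),
      forall x : H, exists c : 'I_n -> R, x = \sum_(i < n) c i *: e i.

(* An unbounded operator; the values of [op] outside [dom] are irrelevant. *)
Record operator {R : realType} (H : completeNormedModType R) : Type :=
  Operator { dom : set H ; op :> H -> H }.
Arguments Operator {R H}.

Section Operators.
Context {R : realType} {H : completeNormedModType R}.
Variable dot : {dot H for idfun}.
Implicit Types (A : operator H) (V : set H) (G : H -> H).

Definition linear_operator A : Prop :=
  dom A 0 /\
  forall (a : R) (x y : H), dom A x -> dom A y ->
    dom A (a *: x + y) /\ A (a *: x + y) = a *: A x + A y.

(* The last clause says that the adjoint of [A] (its domain included) is [A]. *)
Definition self_adjoint A : Prop :=
  [/\ linear_operator A,
      dense (dom A) &
      forall y z : H,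
        (forall x, dom A x -> dot (A x) y = dot x z) <-> (dom A y /\ A y = z)].

Definition nonnegative A : Prop := forall x, dom A x -> 0 <= dot (A x) x.

(* [G] is the bounded inverse of [A - l], where [A] is seen as an operator in
   the subspace [V] with domain [dom A `&` V]. *)
Definition is_resolvent V A (l : R) G : Prop :=
  [/\ forall y, V y -> [/\ V (G y), dom A (G y) & A (G y) - l *: G y = y],
      forall x, V x -> dom A x -> G (A x - l *: x) = x &
      exists C : R, forall y, V y -> `|G y| <= C * `|y|].

Definition spectrum_on V A : set R :=
  [set l | ~ exists G, is_resolvent V A l G].

Definition compact_resolvent A : Prop :=
  exists (l : R) (G : H -> H),
    is_resolvent setT A l G /\
    forall B : set H, bounded_set B -> precompact (G @` B).

(* Borel functional calculus: [E B] is the spectral projection 1_B(A).  For each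
   [x], [m x] is the finite measure B |-> <E(B) x, x>; since H is real and A
   symmetric, the quadratic form <A x, x> determines A by polarization. *)
Definition orthogonal_projection G : Prop :=
  [/\ forall (a : R) (x y : H), G (a *: x + y) = a *: G x + G y,
      forall x, G (G x) = G x &
      forall x y, dot (G x) y = dot x (G y)].

Definition spectral_measure A (E : set R -> H -> H) : Prop :=
  [/\ forall B, measurable B -> orthogonal_projection (E B),
      forall x, E setT x = x,
      forall B C, measurable B -> measurable C ->
        forall x, E (B `&` C) x = E B (E C x) &
      exists m : H -> {measure set (measurableTypeR R) -> \bar R},
        [/\ forall x (B : set R), measurable B ->
              m x B = (dot (E B x) x)%:E,
            forall x, dom A x <-> (\int[m x]_l ((l : R) ^+ 2)%:E < +oo)%E &
            forall x, dom A x -> (dot (A x) x)%:E = (\int[m x]_l (l : R)%:E)%E]].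

End Operators.

Section Evolution.
Context {R : realType} {H : completeNormedModType R}.
Variable dot : {dot H for idfun}.
Implicit Types (A : operator H) (T S : R -> H -> H) (F : H -> H).

Definition C0_semigroup T : Prop :=
  [/\ forall t : R, 0 <= t ->
        (forall (a : R) (x y : H), T t (a *: x + y) = a *: T t x + T t y) /\
        continuous (T t),
      forall x, T 0 x = x,
      forall (s t : R) x, 0 <= s -> 0 <= t -> T (s + t) x = T s (T t x) &
      forall x, T t x @[t --> 0^'+] --> x].

(* [T t] is e^{-tA}: the infinitesimal generator of [T] is [- A]. *)
Definition generated_by_opp A T : Prop :=
  forall x y : H,
    (t^-1 *: (T t x - x) @[t --> 0^'+] --> y) <-> (dom A x /\ y = - A x).

(* [w] is the H-valued (weak, i.e. Gelfand-Pettis) integral of [f] over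
   [[a, b]]; it agrees with the Riemann and Bochner integrals for continuous
   [f]. *)
Definition vector_integral (f : R -> H) (a b : R) (w : H) : Prop :=
  forall y : H,
    (@lebesgue_measure R).-integrable `[a, b] (fun s => (dot (f s) y)%:E) /\
    dot w y = \int[@lebesgue_measure R]_(s in `[a, b]) dot (f s) y.

(* v(t) = e^{-tA} u0 + \int_0^t e^{-(t-s)A} F(v(s)) ds for all t >= 0. *)
Definition global_mild_solution A F (u0 : H) (v : R -> H) : Prop :=
  exists T : R -> H -> H,
    [/\ C0_semigroup T, generated_by_opp A T,
        {within `[0, +oo[%classic, continuous v} &
        forall t : R, 0 <= t ->
          vector_integral (fun s => T (t - s) (F (v s))) 0 t (v t - T t u0)].

Definition mild_semiflow A F S : Prop :=
  forall u0, global_mild_solution A F u0 (S ^~ u0).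

End Evolution.

Section SpectralSplitting.
Context {R : realType} {H : completeNormedModType R}.
Variables (A : operator H) (E : set R -> H -> H) (mu eps : R).

Definition P_eps : H -> H := E `[0, mu * eps ^- 2]%classic.
Definition Q_eps (x : H) : H := x - P_eps x.

Definition A_eps : operator H :=
  Operator (dom A) (fun x => A x + eps^-1 *: Q_eps x).

(* If P_eps H = {0} the spectrum is empty, and [sup set0 = 0] by [sup0]. *)
Definition beta_eps : R := sup (spectrum_on (range P_eps) A).
Definition lambda_eps : R := inf (spectrum_on (range Q_eps) A).
Definition alpha_eps : R := lambda_eps + eps^-1.
Definition gamma_eps : R := alpha_eps - beta_eps.

Definition c_eps (L : R) : R := Num.sqrt (1 + 16 * L ^+ 2 / gamma_eps ^+ 2).
Definition d_eps (M : R) : R := M / lambda_eps + M / alpha_eps.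

(* The manifold {p + h(p) : p in P_eps H}; [h] is only used on P_eps H. *)
Definition manifold (h : H -> H) : set H :=
  [set p + h p | p in range P_eps].

Definition R_eps (h : H -> H) (u : H) : H := P_eps u + h (P_eps u).

(* Since [R_eps h u0] lies in [manifold h], [Seps t] is applied here as the
   restricted semiflow of the manifold. *)
Definition tracking_error (S Seps : R -> H -> H) (h : H -> H) (u0 : H) : \bar R :=
  ereal_sup [set `|R_eps h (S t u0) - Seps t (R_eps h u0)|%:E
            | t in [set t : R | 0 <= t]].

(* Boundedness and Lipschitz bound of the graph, invariance, and the reduced
   ODE p' + A p = P_eps F(p + h(p)). *)
Definition inertial_manifold (F : H -> H) (M L : R) (S : R -> H -> H)
    (h : H -> H) : Prop :=
  [/\ forall p, range P_eps p -> range Q_eps (h p) /\ `|h p| <= M / alpha_eps,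
      (4 * L / gamma_eps).-lipschitz_(range P_eps) h,
      forall t : R, 0 <= t -> S t @` manifold h = manifold h &
      forall p0, range P_eps p0 ->
        exists p : R -> H,
          [/\ p 0 = p0,
              {within `[0, +oo[%classic, continuous p},
              forall t : R, 0 <= t ->
                range P_eps (p t) /\ S t (p0 + h p0) = p t + h (p t) &
              forall t : R, 0 < t ->
                is_derive t (1 : R) p (P_eps (F (p t + h (p t))) - A (p t))]].

End SpectralSplitting.

(* Main.v *)
Require Import Defs.
From mathcomp Require Import all_boot all_order all_algebra.
From mathcomp Require Import all_classical all_reals all_analysis.
From mathcomp Require Import measurable_realfun.
From mathcomp Require Import ring lra.

(* Write u(t) = S(t) u0 = p + q along the spectral splitting, and let p_eps
   solve the reduced equation on the manifold, with q_eps = h(p_eps).  The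
   restart formula u(t + d) = e^{-dA} u(t) + O(d) gives
   |q(t)| <= e^{-lambda t} |Q u0| + M / lambda, and a strong right derivative
   of p.  Hence the energy identity for eta = p - p_eps and the monotonicity
   hypothesis give
   |eta|' <= - sigma |eta| + L |q - q_eps|, where
   |q - q_eps| <= e^{-lambda t} |Q u0| + d_eps, so |eta| stays below the
   supersolution (L |Q u0| / lambda) (1 - e^{-lambda t}) + (L / sigma) d_eps.
   Since P H and Q H are orthogonal and h is Lipschitz, the tracking error is
   at most c_eps |eta|.  When Q = 0 the convention inf set0 = 0 makes lambda
   vanish, but then q = q_eps = 0 and the error is zero.  Differential
   inequalities are integrated with right derivatives only, by a first crossing
   argument. *)

Set Implicit Arguments.
Unset Strict Implicit.
Unset Printing Implicit Defensive.

Import Order.TTheory GRing.Theory Num.Theory.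
Import numFieldNormedType.Exports.

Local Open Scope classical_set_scope.
Local Open Scope ring_scope.

(** * Hilbert space geometry *)

(** The solution [S t u0] need not enter [dom A], so only its [P] part can be differentiated: the
    spectral cut-off is bounded, hence the range of [P] lies in [dom A]. The complementary part is
    controlled through finite increments instead. The data are given weakly: the spectral measure
    through quadratic forms, the Duhamel integral through pairings, the semigroup through its
    generator at [0^'+]. Commutation of [P] with [A] is recovered by polarization; contraction,
    commutation with [P] and symmetry of [T t] by energy arguments. Symmetry is what lets [T h]
    leave a weak integral: it moves to the test vector. [lambda_eps] is the infimum of a spectrum,
    while energy estimates need a bound on the form of [A]. The bridge is that the infimum of the
    numerical range belongs to the spectrum. The nonlinear difference is split through
    [F (p_eps + q)]: monotonicity absorbs the change in [p], and the Lipschitz bound is spent on the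
    change in [q] only, so [L] and [sigma] need not be compared. The factor [eps ^+ 2] comes from
    [lambda_eps >= mu * eps ^- 2]. *)

Section InnerProduct.
Context {R : realType} {H : completeNormedModType R}.
Variable dot : {dot H for idfun}.

Lemma dotC x y : dot x y = dot y x.
Proof. by rewrite hermC expr0 mul1r. Qed.

Lemma dotDl x y z : dot (x + y) z = dot x z + dot y z.
Proof. exact: linearDl. Qed.

Lemma dotDr x y z : dot z (x + y) = dot z x + dot z y.
Proof. exact: linearDr. Qed.

Lemma dotZl a x y : dot (a *: x) y = a * dot x y.
Proof. by rewrite linearZl_LR. Qed.

Lemma dotZr a x y : dot x (a *: y) = a * dot x y.
Proof. by rewrite linearZr_LR. Qed.

Lemma dotNl x y : dot (- x) y = - dot x y.
Proof. exact: linearNl. Qed.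

Lemma dotBl x y z : dot (x - y) z = dot x z - dot y z.
Proof. exact: linearBl. Qed.

Lemma dotBr x y z : dot z (x - y) = dot z x - dot z y.
Proof. exact: linearBr. Qed.

Lemma dot0l x : dot 0 x = 0.
Proof. exact: linear0l. Qed.

Lemma dot0r x : dot x 0 = 0.
Proof. exact: linear0r. Qed.

End InnerProduct.

Lemma cvg_of_cauchy {R : realType} {V : completeNormedModType R} (v : nat -> V) :
  (forall e : R, 0 < e -> exists N, forall n m, (N <= n)%N -> (N <= m)%N ->
     `|v n - v m| <= e) -> cvgn v.
Proof.
move=> h; apply: cauchy_cvg; apply: cauchy_exP => e e0.
have [N hN] := h _ (divr_gt0 e0 (ltr0n R 2)).
exists (v N); exists N => // n /= Nn.
rewrite -ball_normE /ball_/=; apply: le_lt_trans (hN _ _ (leqnn _) Nn) _.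
by rewrite ltr_pdivrMr// ltr_pMr// ltr1n.
Qed.

(** The discriminant criterion, with [c = 0] allowed so that it covers degenerate forms. It yields
    Cauchy-Schwarz for [dot] and for the form of [A - l], and the orthogonality at a distance
    minimizer. *)
Lemma discr_le0 {R : realType} (a b c : R) : 0 <= a -> 0 <= c ->
  (forall s : R, 0 <= a + 2 * s * b + s ^+ 2 * c) -> b ^+ 2 <= a * c.
Proof.
move=> a0; rewrite le_eqVlt => /predU1P[<- h|c0 h].
  have [->|bn0] := eqVneq b 0; first by rewrite expr0n mulr0.
  (* Here [c = 0], and at this point the affine polynomial equals [-1]. *)
  have := h (- (a + 1) / (2 * b)).
  rewrite mulr0 addr0 (_ : 2 * (- (a + 1) / (2 * b)) * b = - (a + 1)); last first.
    by field.
  lra.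
have := h (- b / c).
rewrite (_ : a + _ + _ = (a * c - b ^+ 2) / c); last by field; lra.
by rewrite pmulr_lge0 ?invr_gt0// subr_ge0.
Qed.

Section Hilbert.
Context {R : realType} {H : completeNormedModType R}.
Variable dot : {dot H for idfun}.
Hypothesis norm_dot : hilbert_norm dot.

Lemma dot_ge0 (x : H) : 0 <= dot x x.
Proof. by rewrite -norm_dot exprn_ge0. Qed.

Lemma cauchy_schwarz (x y : H) : `|dot x y| <= `|x| * `|y|.
Proof.
rewrite -[leLHS]ger0_norm// -ler_sqr ?nnegrE ?mulr_ge0// normr_id exprMn.
rewrite -normrX ger0_norm ?sqr_ge0// !norm_dot.
apply: discr_le0; [exact: dot_ge0|exact: dot_ge0|move=> s].
have := dot_ge0 (x + s *: y).
rewrite !dotDl !dotDr !dotZl !dotZr (dotC _ y x).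
by congr (0 <= _); ring.
Qed.

Lemma dot_le (x y : H) : dot x y <= `|x| * `|y|.
Proof. exact: le_trans (ler_norm _) (cauchy_schwarz _ _). Qed.

(** Testing with [y = x] suffices. Vector integrals are known only through pairings, so this is how
    their norms are bounded. *)
Lemma norm_le_dual (x : H) (C : R) : 0 <= C ->
  (forall y, dot x y <= C * `|y|) -> `|x| <= C.
Proof.
move=> C0 /(_ x); rewrite -norm_dot expr2.
by have [->|xn0] := eqVneq x 0; rewrite ?normr0// ler_pM2r ?normr_gt0.
Qed.

Lemma dot_inj (x y : H) : (forall z, dot x z = dot y z) -> x = y.
Proof.
move=> xy; apply/subr0_eq/eqP; rewrite -normr_eq0 -sqrf_eq0 norm_dot.
by rewrite dotBl xy subrr.
Qed.

Lemma cvg_dot {T : Type} {F : set_system T} {FF : Filter F} (f g : T -> H) a b :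
  f @ F --> a -> g @ F --> b -> (fun t => dot (f t) (g t)) @ F --> dot a b.
Proof.
move=> /cvgrPdist_le fa /cvgrPdist_le gb; apply/cvgrPdist_le => e e0.
have k0 : 0 < `|a| + `|b| + 1 by rewrite ltr_wpDl ?addr_ge0.
(* The cap at [1] bounds the product of the two errors by [d], so all three terms sum to at most
   [d * (|a| + |b| + 1)]. *)
pose d := Num.min 1 (e / (`|a| + `|b| + 1)).
have d0 : 0 < d by rewrite lt_min ltr01 divr_gt0.
apply: filterS2 (fa _ d0) (gb _ d0) => t ft gt.
have -> : dot a b - dot (f t) (g t) = dot (a - f t) b + dot a (b - g t)
    - dot (a - f t) (b - g t).
  by rewrite !(dotBl, dotBr); ring.
apply: (@le_trans _ _ (d * (`|a| + `|b| + 1))); last first.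
  by rewrite -ler_pdivlMr// ge_min lexx orbT.
have d1 : d <= 1 by rewrite ge_min lexx.
have h1 := cauchy_schwarz (a - f t) b.
have h2 := cauchy_schwarz a (b - g t).
have h3 := cauchy_schwarz (a - f t) (b - g t).
have h1' : `|a - f t| * `|b| <= d * `|b| by rewrite ler_wpM2r.
have h2' : `|a| * `|b - g t| <= `|a| * d by rewrite ler_wpM2l.
have h3' : `|a - f t| * `|b - g t| <= d * 1.
  by apply: ler_pM => //; exact: le_trans gt d1.
apply: le_trans (ler_normB _ _) _; apply: le_trans (lerD (ler_normD _ _) (lexx _)) _.
lra.
Qed.

Lemma cvg_dotr {T : Type} {F : set_system T} {FF : Filter F} x (f : T -> H) a :
  f @ F --> a -> (fun t => dot x (f t)) @ F --> dot x a.
Proof. by move=> fa; apply: cvg_dot fa; exact: cvg_cst. Qed.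

Lemma orthogonal_norm (x y : H) : dot x y = 0 ->
  `|x + y| ^+ 2 = `|x| ^+ 2 + `|y| ^+ 2.
Proof.
move=> xy; rewrite !norm_dot !dotDl !dotDr (dotC _ y x) xy; ring.
Qed.

Lemma parallelogram (x y : H) :
  `|x - y| ^+ 2 = 2 * `|x| ^+ 2 + 2 * `|y| ^+ 2 - `|x + y| ^+ 2.
Proof. by rewrite !norm_dot !(dotBl, dotBr, dotDl, dotDr) (dotC _ y x); ring. Qed.

(* A minimizing sequence for the distance to [V] is Cauchy by the
   parallelogram identity. *)
Lemma orthogonal_decomposition (V : set H) (y : H) :
  closed V -> V 0 -> (forall (a : R) u v, V u -> V v -> V (a *: u + v)) ->
  exists2 v, V v & forall w, V w -> dot (y - v) w = 0.
Proof.
move=> cV V0 lV.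
pose D := [set `|y - v| | v in V].
have D0 : D !=set0 by exists `|y - 0|; exists 0.
have lbD : lbound D 0 by move=> _ [v _ <-].
have hD : has_inf D by split => //; exists 0.
pose d := inf D.
have d_ge0 : 0 <= d by exact: lb_le_inf.
have dle v : V v -> d <= `|y - v|.
  by move=> Vv; apply: ge_inf; [exists 0|exists v].
have /choice[v hv] : forall n : nat, exists v, V v /\ `|y - v| < d + n.+1%:R^-1.
  move=> n; have e0 : 0 < n.+1%:R^-1 :> R by rewrite invr_gt0.
  by have [_ [v Vv <-] ?] := inf_adherent e0 hD; exists v.
have Vmid u w : V u -> V w -> V (2^-1 *: (u + w)).
  move=> Vu Vw; rewrite scalerDr -[X in _ + X]addr0 ; apply: (lV) => //.
  exact: lV.
(* The midpoint lies in [V], hence at distance at least [d] from [y]; the parallelogram identity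
   leaves [4 (d + e)^2 - 4 d^2 = 8 d e + 4 e^2], and [e <= 1] makes this linear in [e]. *)
have dist_le n m (e : R) : n.+1%:R^-1 <= e -> m.+1%:R^-1 <= e -> e <= 1 ->
    `|v n - v m| ^+ 2 <= (8 * d + 4) * e.
  move=> ne me e1.
  have [Vn hn] := hv n; have [Vm hm] := hv m.
  have -> : v n - v m = (y - v m) - (y - v n).
    by rewrite opprB [RHS]addrC addrA subrK.
  rewrite parallelogram.
  have -> : y - v m + (y - v n) = 2 *: (y - 2^-1 *: (v n + v m)).
    rewrite scalerBr scalerA divff ?scale1r// scaler_nat mulr2n opprD.
    by rewrite addrACA (addrC (- v m)).
  have := dle _ (Vmid _ _ Vn Vm).
  rewrite normrZ ger0_norm// => hmid.
  have sqle (x : R) : 0 <= x -> x <= d + e -> x ^+ 2 <= (d + e) ^+ 2.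
    by move=> x0 xde; rewrite ler_sqr ?nnegrE//; apply: le_trans x0 xde.
  have h1 := sqle _ (normr_ge0 _) (le_trans (ltW hn) (lerD (lexx d) ne)).
  have h2 := sqle _ (normr_ge0 _) (le_trans (ltW hm) (lerD (lexx d) me)).
  have h3 : d ^+ 2 <= `|y - 2^-1 *: (v n + v m)| ^+ 2.
    by rewrite ler_sqr ?nnegrE.
  have e0 : 0 <= e by apply: le_trans ne; rewrite invr_ge0.
  have : e * e <= e by rewrite ler_piMr.
  rewrite exprMn; nra.
have /cvg_ex[l vl] : cvgn v.
  apply: cvg_of_cauchy => e e0.
  have c0 : 0 < 8 * d + 4 by rewrite ltr_wpDl ?mulr_ge0.
  pose r := Num.min 1 (e ^+ 2 / (8 * d + 4)).
  have r0 : 0 < r by rewrite lt_min ltr01 divr_gt0// exprn_gt0.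
  have [N _ hN] := near_infty_natSinv_lt (PosNum r0).
  exists N => n m Nn Nm.
  rewrite -ler_sqr ?nnegrE ?(ltW e0)//.
  apply: (@le_trans _ _ ((8 * d + 4) * r)).
    apply: dist_le; [exact/ltW/hN|exact/ltW/hN|by rewrite ge_min lexx].
  by rewrite mulrC -ler_pdivlMr// ge_min lexx orbT.
have Vl : V l.
  by apply: closed_cvg cV _ _ vl; apply: nearW => n; have [] := hv n.
have lmin : `|y - l| = d.
  apply/eqP; rewrite eq_le dle// andbT.
  apply/ler_addgt0Pr => e e0.
  have /cvgrPdist_le/(_ (e / 2)) : v @ \oo --> l by [].
  rewrite divr_gt0// => /(_ isT) h1.
  have h2 := near_infty_natSinv_lt (PosNum (divr_gt0 e0 (ltr0n R 2))).
  have [n [/= hn1 hn2]] : exists n, `|l - v n| <= e / 2 /\ n.+1%:R^-1 < e / 2.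
    near \oo => n; exists n; split; near: n; [exact: h1|exact: h2].
  have [_ hn] := hv n.
  have -> : y - l = (y - v n) - (l - v n) by rewrite opprB addrA subrK.
  apply: le_trans (ler_normB _ _) _.
  by rewrite [e]splitr addrA lerD// ltW// (lt_trans hn)// ltrD2l.
exists l => // w Vw.
(* Comparing [l] with the competitor [l - s w] gives a nonnegative quadratic in [s] without constant
   term, whose discriminant forces the linear coefficient to vanish. *)
suff : dot (y - l) w ^+ 2 <= 0 * dot w w.
  by rewrite mul0r => h; apply/eqP; rewrite -sqrf_eq0 eq_le h sqr_ge0.
apply: discr_le0 => // [|s]; first exact: dot_ge0.
have Vs : V (- s *: w + l) by exact: lV.
have := dle _ Vs.
rewrite -lmin -ler_sqr ?nnegrE// !norm_dot.
have -> : y - (- s *: w + l) = s *: w + (y - l).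
  by rewrite opprD scaleNr opprK addrCA.
move: (y - l) => z.
rewrite dotDl !dotDr !dotZl !dotZr (dotC _ w z) => h.
have -> : 0 + 2 * s * dot z w + s ^+ 2 * dot w w =
  (s * (s * dot w w) + s * dot z w + (s * dot z w + dot z z)) - dot z z by ring.
by rewrite subr_ge0.
Unshelve. all: by end_near.
Qed.

End Hilbert.

(** * Self-adjoint operators *)

Section SelfAdjoint.
Context {R : realType} {H : completeNormedModType R}.
Variable dot : {dot H for idfun}.
Hypothesis norm_dot : hilbert_norm dot.
Variable A : operator H.
Hypothesis A_self_adjoint : self_adjoint dot A.

Lemma dom0 : dom A 0.
Proof. by case: A_self_adjoint => -[]. Qed.

Lemma op_comb (a : R) x y : dom A x -> dom A y ->
  dom A (a *: x + y) /\ A (a *: x + y) = a *: A x + A y.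
Proof. by case: A_self_adjoint => -[_ h] _ _; exact: h. Qed.

Lemma domD x y : dom A x -> dom A y -> dom A (x + y).
Proof. by move=> dx dy; have [] := op_comb 1 dx dy; rewrite scale1r. Qed.

Lemma opD x y : dom A x -> dom A y -> A (x + y) = A x + A y.
Proof. by move=> dx dy; have [_] := op_comb 1 dx dy; rewrite !scale1r. Qed.

Lemma op0 : A 0 = 0.
Proof.
have := opD dom0 dom0; rewrite addr0 => /eqP.
by rewrite -subr_eq0 opprD addrA subrr sub0r oppr_eq0 => /eqP.
Qed.

Lemma domZ a x : dom A x -> dom A (a *: x).
Proof. by move=> dx; have [] := op_comb a dx dom0; rewrite addr0. Qed.

Lemma opZ a x : dom A x -> A (a *: x) = a *: A x.
Proof.
by move=> dx; have [_] := op_comb a dx dom0; rewrite op0 !addr0.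
Qed.

Lemma domB x y : dom A x -> dom A y -> dom A (x - y).
Proof. by move=> dx dy; rewrite -scaleN1r; apply: domD => //; exact: domZ. Qed.

Lemma opB x y : dom A x -> dom A y -> A (x - y) = A x - A y.
Proof.
by move=> dx dy; rewrite -scaleN1r opD ?opZ//; [rewrite scaleN1r|exact: domZ].
Qed.

Lemma op_sym x y : dom A x -> dom A y -> dot (A x) y = dot x (A y).
Proof.
move=> dx dy; case: A_self_adjoint => _ _ /(_ y (A y)) [_]; exact.
Qed.

Lemma adjointP y z : (forall x, dom A x -> dot (A x) y = dot x z) ->
  dom A y /\ A y = z.
Proof. by case: A_self_adjoint => _ _ h /h. Qed.

Lemma dom_seq (x : H) :
  exists2 u : nat -> H, (forall n, dom A (u n)) & u @ \oo --> x.
Proof.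
case: A_self_adjoint => _ dA _.
have /choice[u hu] : forall n : nat, exists u, dom A u /\ `|x - u| < n.+1%:R^-1.
  move=> n; have e0 : 0 < n.+1%:R^-1 :> R by rewrite invr_gt0.
  have [||u [xu du]] := dA (ball x n.+1%:R^-1).
  - by exists x; exact: ballxx.
  - exact: ball_open.
  - by exists u; split => //; move: xu; rewrite -ball_normE.
exists u => [n|]; first by have [] := hu n.
apply/cvgrPdist_lt => e e0.
have [N _ hN] := near_infty_natSinv_lt (PosNum e0).
exists N => // n Nn; have [_ h] := hu n; apply: lt_trans h _; exact: hN.
Qed.

Lemma dom_total x : (forall y, dom A y -> dot x y = 0) -> x = 0.
Proof.
move=> h; have [u du ux] := dom_seq x.
apply: (dot_inj norm_dot) => z; rewrite dot0l.
suff : dot x x = 0.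
  rewrite -norm_dot => /eqP; rewrite sqrf_eq0 normr_eq0 => /eqP ->.
  by rewrite dot0l.
have : (fun n => dot x (u n)) @ \oo --> dot x x by exact: cvg_dotr.
have -> : (fun n => dot x (u n)) = cst 0 by apply/funext => n; rewrite h.
by move=> h0; apply: (cvg_unique (@Rhausdorff R) h0); exact: cvg_cst.
Qed.

(** [A] equals its adjoint, and the relation defining the adjoint passes to limits in both
    arguments. *)
Lemma op_closed (u : nat -> H) (x z : H) : (forall n, dom A (u n)) ->
  u @ \oo --> x -> A \o u @ \oo --> z -> dom A x /\ A x = z.
Proof.
move=> du ux Auz; apply: adjointP => y dy.
have h1 : (fun n => dot (A y) (u n)) @ \oo --> dot (A y) x by exact: cvg_dotr.
have h2 : (fun n => dot y (A (u n))) @ \oo --> dot y z.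
  exact: (cvg_dotr norm_dot Auz).
rewrite (_ : (fun n => _) = (fun n => dot y (A (u n)))) in h1.
  exact: (cvg_unique (@Rhausdorff R) h1 h2).
by apply/funext => n /=; rewrite op_sym.
Qed.

(** Positivity of the form of [A - l] is required only along the line through [x] and [y], so that
    the inequality can be applied inside the kernel of [P], where [l] is a lower bound. *)
Lemma op_cauchy_schwarz (l : R) x y : dom A x -> dom A y ->
  (forall s : R, 0 <= dot (A (x + s *: y) - l *: (x + s *: y)) (x + s *: y)) ->
  dot (A x - l *: x) y ^+ 2 <=
    dot (A x - l *: x) x * dot (A y - l *: y) y.
Proof.
move=> dx dy h.
have hs s : 0 <= dot (A x - l *: x) x + 2 * s * dot (A x - l *: x) y
    + s ^+ 2 * dot (A y - l *: y) y.
  have := h s; rewrite opD ?opZ//; last exact: domZ.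
  rewrite !(dotBl, dotDl, dotDr, dotZl, dotZr) (op_sym dy dx).
  rewrite (dotC _ y (A x)) (dotC _ y x).
  by congr (0 <= _); ring.
apply: discr_le0 => //; first by have := hs 0; rewrite expr0n /=; lra.
rewrite leNgt; apply/negP => c0.
set a := dot (A x - _) x in hs *; set b := dot (A x - _) y in hs *.
set c := dot (A y - _) _ in hs c0 *.
have a0 : 0 <= a by have := hs 0; rewrite expr0n /=; lra.
have s0 : 0 <= (a + 1) / - c by rewrite divr_ge0 ?addr_ge0// oppr_ge0 ltW.
(* Were [c] negative, adding the inequalities at these two opposite points would cancel [b] and
   leave [a + s^2 c >= 0], which fails for this [s]. *)
have h1 := hs (1 + (a + 1) / - c).
have h2 := hs (- (1 + (a + 1) / - c)).
have h3 : (a + 1) / - c * c = - (a + 1) by field; lra.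
move: ((a + 1) / - c) h1 h2 h3 s0 => t; nra.
Qed.

End SelfAdjoint.

(** * Orthogonal projections and their complements *)

Section OrthogonalProjection.
Context {R : realType} {H : completeNormedModType R}.
Variable dot : {dot H for idfun}.
Hypothesis norm_dot : hilbert_norm dot.
Variable P : H -> H.
Hypothesis P_proj : orthogonal_projection dot P.

Lemma projD x y : P (x + y) = P x + P y.
Proof. by case: P_proj => lP _ _; have := lP 1 x y; rewrite !scale1r. Qed.

Lemma proj0 : P 0 = 0.
Proof. by apply: (@addrI _ (P 0)); rewrite -projD !addr0. Qed.

Lemma projZ a x : P (a *: x) = a *: P x.
Proof. by case: P_proj => lP _ _; have := lP a x 0; rewrite proj0 !addr0. Qed.

Lemma projN x : P (- x) = - P x.
Proof. by rewrite -scaleN1r projZ scaleN1r. Qed.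

Lemma projB x y : P (x - y) = P x - P y.
Proof. by rewrite projD projN. Qed.

Lemma proj_idem x : P (P x) = P x.
Proof. by case: P_proj. Qed.

Lemma proj_sym x y : dot (P x) y = dot x (P y).
Proof. by case: P_proj. Qed.

Lemma proj_compl x : P (x - P x) = 0.
Proof. by rewrite projB proj_idem subrr. Qed.

Lemma proj_ortho x y : P y = 0 -> dot (P x) y = 0.
Proof. by move=> Py; rewrite proj_sym Py dot0r. Qed.

Lemma norm_proj x : `|x| ^+ 2 = `|P x| ^+ 2 + `|x - P x| ^+ 2.
Proof.
have h : dot (P x) (x - P x) = 0 by apply: proj_ortho; exact: proj_compl.
by have := orthogonal_norm norm_dot h; rewrite [P x + _]addrC subrK.
Qed.

Lemma proj_contract x : `|P x| <= `|x|.
Proof. by rewrite -ler_sqr ?nnegrE// (norm_proj x) lerDl sqr_ge0. Qed.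

Lemma compl_contract x : `|x - P x| <= `|x|.
Proof. by rewrite -ler_sqr ?nnegrE// (norm_proj x) lerDr sqr_ge0. Qed.

Lemma range_proj x : range P x <-> P x = x.
Proof. by split=> [[y _ <-]|<-]; [exact: proj_idem|exists x]. Qed.

Lemma range_compl x : range (fun y => y - P y) x <-> P x = 0.
Proof.
split=> [[y _ <-]|Px]; first exact: proj_compl.
by exists x => //; rewrite Px subr0.
Qed.

Lemma compl_orthogonal_projection : orthogonal_projection dot (fun x => x - P x).
Proof.
split=> [a x y|x|x y].
- by rewrite projD projZ scalerBr opprD addrACA.
- by rewrite proj_compl subr0.
- by rewrite dotBl dotBr proj_sym.
Qed.

Lemma cvg_proj {T : Type} {F : set_system T} {FF : Filter F} (f : T -> H) a :
  f @ F --> a -> (fun t => P (f t)) @ F --> P a.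
Proof.
move=> /cvgrPdist_le fa; apply/cvgrPdist_le => e /fa; apply: filterS => t.
by apply: le_trans; rewrite -projB proj_contract.
Qed.

End OrthogonalProjection.

(** * Spectral projections *)

(** More than a reducing subspace: [rp_dom] puts the whole range of [P] in the domain, as for a
    bounded spectral window. This is what makes [P v] differentiable along a mild solution [v]. *)
Record reducing_projection {R : realType} {H : completeNormedModType R}
    (dot : {dot H for idfun}) (A : operator H) (P : H -> H) : Prop := {
  rp_projection : orthogonal_projection dot P ;
  rp_dom : forall x, dom A (P x) ;
  rp_comm : forall x, dom A x -> A (P x) = P (A x) }.

Section SpectralMeasure.
Context {R : realType} {H : completeNormedModType R}.
Variable dot : {dot H for idfun}.
Hypothesis norm_dot : hilbert_norm dot.
Variable A : operator H.
Hypothesis A_self_adjoint : self_adjoint dot A.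
Hypothesis A_nonneg : nonnegative dot A.
Variable E : set R -> H -> H.
Variable m : H -> {measure set (measurableTypeR R) -> \bar R}.
Hypothesis E_proj : forall B, measurable B -> orthogonal_projection dot (E B).
Hypothesis E_setT : forall x, E setT x = x.
Hypothesis E_setI : forall B C, measurable B -> measurable C ->
  forall x, E (B `&` C) x = E B (E C x).
Hypothesis mE : forall x (B : set R), measurable B -> m x B = (dot (E B x) x)%:E.
Hypothesis dom_int :
  forall x, dom A x <-> (\int[m x]_l ((l : R) ^+ 2)%:E < +oo)%E.
Hypothesis op_int :
  forall x, dom A x -> (dot (A x) x)%:E = (\int[m x]_l (l : R)%:E)%E.

Lemma measurable_id_EFin D :
  measurable_fun (D : set (measurableTypeR R)) (fun l : R => l%:E).
Proof. by apply/measurable_EFinP; exact: measurable_id. Qed.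

(** [E B] is a symmetric idempotent commuting with [E C], so its two copies in the form collapse
    into one. Localizing a vector thus restricts its spectral measure. *)
Lemma m_restrict B C x : measurable B -> measurable C ->
  m (E B x) C = m x (C `&` B).
Proof.
move=> mB mC; have [_ _ Bs] := E_proj mB.
rewrite !mE//; last exact: measurableI.
by rewrite E_setI// -Bs -!E_setI//; [rewrite setIAC setIid setIC|
  exact: measurableI].
Qed.

Lemma int_restrict B x (f : R -> \bar R) : measurable B ->
  measurable_fun (setT : set (measurableTypeR R)) f ->
  (\int[m (E B x)]_l f l = \int[m x]_(l in B) f l)%E.
Proof.
move=> mB mf; have mC : measurable (~` B) by exact: measurableC.
have -> : (\int[m (E B x)]_l f l = \int[m (E B x)]_(l in B `|` ~` B) f l)%E.
  by rewrite setUv.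
rewrite integral_setU//; last 2 first.
- by rewrite setUv.
- by apply/disj_setPS; rewrite setICr.
have -> : (\int[m (E B x)]_(l in ~` B) f l = 0)%E.
  apply: null_set_integral => //; first exact: measurable_funTS.
  by rewrite m_restrict// setICl measure0.
rewrite adde0.
apply: eq_measure_integral => C mC' CB.
by rewrite m_restrict// setIidl.
Qed.

Lemma E_dom B x : measurable B -> dom A x -> dom A (E B x).
Proof.
move=> mB /dom_int dx; apply/dom_int.
have mf : measurable_fun (setT : set (measurableTypeR R))
    (fun l : R => (l ^+ 2)%:E).
  by apply/measurable_EFinP; apply: measurable_funX; exact: measurable_id.
rewrite int_restrict//; apply: le_lt_trans dx.
by apply: ge0_subset_integral => // l _; rewrite lee_fin sqr_ge0.
Qed.

(** On the window [l ^+ 2] is at most [a ^+ 2] and [m x] is finite, so the second moment converges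
    for every [x]. *)
Lemma E_bounded_dom (a : R) x : dom A (E `[0, a]%classic x).
Proof.
have mB : measurable (`[0, a]%classic : set R) by exact: measurable_itv.
apply/dom_int.
have mf : measurable_fun (setT : set (measurableTypeR R))
    (fun l : R => (l ^+ 2)%:E).
  by apply/measurable_EFinP; apply: measurable_funX; exact: measurable_id.
rewrite int_restrict//.
apply: (@le_lt_trans _ _ (\int[m x]_(l in `[0%R, a]%classic) (cst (a ^+ 2)%:E l))%E).
  apply: ge0_le_integral => //.
  - by move=> l _; rewrite lee_fin sqr_ge0.
  - exact: measurable_funTS.
  - move=> l /=; rewrite in_itv/= => /andP[l0 la].
    by rewrite lee_fin ler_sqr ?nnegrE// (le_trans l0 la).
by rewrite integral_cst// mE// -EFinM ltry.
Qed.

(** Additivity of the integral over [B] and its complement: the form has no cross term. Polarizing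
    this gives the commutation of [E B] with [A]. *)
Lemma op_split B x : measurable B -> dom A x ->
  dot (A x) x = dot (A (E B x)) (E B x) + dot (A (E (~` B) x)) (E (~` B) x).
Proof.
move=> mB dx; have mC : measurable (~` B) by exact: measurableC.
have mid D := @measurable_id_EFin D.
apply: EFin_inj; rewrite EFinD !op_int//; try exact: E_dom.
rewrite !int_restrict//.
have -> : (\int[m x]_l (l : R)%:E = \int[m x]_(l in B `|` ~` B) (l : R)%:E)%E.
  by rewrite setUv.
rewrite integral_setU//.
by apply/disj_setPS; rewrite setICr.
Qed.

Lemma E_set0 x : E set0 x = 0.
Proof.
apply/eqP; rewrite -normr_eq0 -sqrf_eq0 norm_dot; apply/eqP.
have [_ idem sym] := E_proj measurable0.
by rewrite sym idem dotC; apply: EFin_inj; rewrite -mE// measure0.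
Qed.

(** Additivity is available only for the scalar measures [m x], so the operator identity is obtained
    by expanding the squared norm of the difference and finding [0]. *)
Lemma E_setC B x : measurable B -> E (~` B) x = x - E B x.
Proof.
move=> mB; have mC : measurable (~` B) by exact: measurableC.
have [_ idB symB] := E_proj mB; have [_ idC symC] := E_proj mC.
have hm : dot x x = dot (E B x) x + dot (E (~` B) x) x.
  have : (m x (B `|` ~` B) = m x B + m x (~` B))%E.
    by apply: measureU => //; exact: setICr.
  by rewrite setUv !mE// E_setT => -[].
have hBB : dot (E B x) (E B x) = dot (E B x) x by rewrite -symB idB.
have hCC : dot (E (~` B) x) (E (~` B) x) = dot (E (~` B) x) x.
  by rewrite -symC idC.
have hBC : dot (E B x) (E (~` B) x) = 0.
  by rewrite symB -E_setI// setICr E_set0 dot0r.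
apply/esym/subr0_eq/eqP; rewrite -normr_eq0 -sqrf_eq0 norm_dot; apply/eqP.
rewrite !(dotBl, dotBr) (dotC _ x (E B x)) (dotC _ x (E (~` B) x)).
rewrite (dotC _ (E (~` B) x) (E B x)) hBB hCC hBC; lra.
Qed.

Lemma E_reducing (a : R) : reducing_projection dot A (E `[0, a]%classic).
Proof.
have mB : measurable (`[0, a]%classic : set R) by exact: measurable_itv.
set B := `[0, a]%classic in mB *.
have B_proj := E_proj mB; have [_ idB symB] := B_proj.
have dB x : dom A (E B x) by exact: E_bounded_dom.
(* Apply the splitting of the form to the sum of [E B x] and [y - E B y]; the diagonal terms cancel
   and, by symmetry of [A], twice the cross term remains. *)
have cross x y : dom A y -> dot (A (E B x)) (y - E B y) = 0.
  move=> dy; have dCy : dom A (y - E B y) by exact: (domB A_self_adjoint).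
  have Bz : E B (E B x + (y - E B y)) = E B x.
    by rewrite (projD B_proj) (proj_compl B_proj) addr0 idB.
  have := op_split mB (domD A_self_adjoint (dB x) dCy).
  rewrite E_setC// Bz addrAC subrr add0r (opD A_self_adjoint)//.
  rewrite dotDl !dotDr (dotC _ (A (y - E B y)) (E B x)).
  by rewrite -(op_sym A_self_adjoint (dB x) dCy); lra.
have symBC x y : dot (x - E B x) y = dot x (y - E B y).
  by rewrite dotBl dotBr symB.
split=> // x dx.
have h1 : A (E B x) - E B (A (E B x)) = 0.
  apply: (dom_total norm_dot A_self_adjoint) => y dy.
  by rewrite symBC; exact: cross.
have dCx : dom A (x - E B x) by exact: (domB A_self_adjoint).
have h2 : E B (A (x - E B x)) = 0.
  apply: (dot_inj norm_dot) => y; rewrite dot0l symB.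
  by rewrite (op_sym A_self_adjoint)// dotC cross.
rewrite (subr0_eq h1) -{2}(subrK (E B x) x) (opD A_self_adjoint)//.
by rewrite (projD B_proj) h2 add0r.
Qed.

(** The integral of [l] over the negative half-line is the form of [A] at a localized vector, hence
    nonnegative, although its integrand is negative. The spectral window starts at [0], so this
    half-line has to be excluded separately. *)
Lemma m_neg x : dom A x -> m x `]-oo, 0[%classic = 0%E.
Proof.
move=> dx; set N := `]-oo, 0[%classic.
have mN : measurable (N : set R) by exact: measurable_itv.
have mid := @measurable_id_EFin N.
have : (0 <= \int[m x]_(l in N) (l : R)%:E)%E.
  rewrite -(int_restrict x mN (@measurable_id_EFin setT)).
  rewrite -op_int; last exact: E_dom.
  by rewrite lee_fin; apply: A_nonneg; exact: E_dom.
have -> : (\int[m x]_(l in N) (l : R)%:E = - \int[m x]_(l in N) `|(l : R)%:E|)%E.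
  rewrite -integral_ge0N//; apply: eq_integral => l.
  rewrite inE /N/= in_itv/= => l0.
  by rewrite ltr0_norm// opprK.
rewrite leeNr oppe0 => h.
have h0 : (\int[m x]_(l in N) `|(l : R)%:E| = 0)%E.
  by apply/eqP; rewrite eq_le h integral_ge0.
have [Z [mZ Z0 hZ]] := (ae_eq_integral_abs (m x) mN mid).1 h0.
apply/eqP; rewrite eq_le measure_ge0 andbT -Z0.
apply: le_measure; rewrite ?inE// => l Nl; apply: hZ => /= /(_ Nl) [] l0.
by move: Nl; rewrite /N/= in_itv/= l0 ltxx.
Qed.

(** The measure [m x] has total mass [|x|^2] and charges neither the negative half-line nor the
    window, so it lives where [l > a]. *)
Lemma op_lower_bound (a : R) x : 0 <= a -> dom A x -> E `[0, a]%classic x = 0 ->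
  a * `|x| ^+ 2 <= dot (A x) x.
Proof.
move=> a0 dx Ex0.
have mB : measurable (`[0, a]%classic : set R) by exact: measurable_itv.
have mN : measurable (`]-oo, 0[%classic : set R) by exact: measurable_itv.
have mB0 : m x `[0, a]%classic = 0%E by rewrite (mE x mB) Ex0 dot0l.
have mN0 := m_neg dx.
set B := `[0, a]%classic in mB mB0 *; set N := `]-oo, 0[%classic in mN mN0 *.
have mU : measurable (N `|` B) by exact: measurableU.
have mC : measurable (~` (N `|` B)) by exact: measurableC.
have mid D := @measurable_id_EFin D.
have U0 : m x (N `|` B) = 0%E.
  apply/eqP; rewrite eq_le measure_ge0 andbT.
  have : (m x (N `|` B) <= m x N + m x B)%E by exact: measureU2.
  by rewrite mN0 mB0 adde0.
have Cx : m x (~` (N `|` B)) = (`|x| ^+ 2)%:E.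
  have : (m x ((N `|` B) `|` ~` (N `|` B)) =
      m x (N `|` B) + m x (~` (N `|` B)))%E.
    by apply: measureU => //; exact: setICr.
  by rewrite setUv U0 add0e norm_dot => <-; rewrite mE// E_setT.
rewrite -lee_fin op_int//.
have -> : (\int[m x]_l (l : R)%:E =
    \int[m x]_(l in (N `|` B) `|` ~` (N `|` B)) (l : R)%:E)%E by rewrite setUv.
rewrite integral_setU//; last first.
  by apply/disj_setPS; rewrite setICr.
have -> : (\int[m x]_(l in N `|` B) (l : R)%:E = 0)%E.
  exact: null_set_integral.
rewrite add0e EFinM -Cx -integral_cst//.
apply: ge0_le_integral => //.
move=> l /= /not_orP[]; rewrite /N /B /= !in_itv/= => /negP l0 /negP.
by rewrite lee_fin; move: l0; rewrite -leNgt => -> /=; rewrite -ltNge => /ltW.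
Qed.

End SpectralMeasure.

(** * The bottom of the spectrum *)

Section BottomOfSpectrum.
Context {R : realType} {H : completeNormedModType R}.
Variable dot : {dot H for idfun}.
Hypothesis norm_dot : hilbert_norm dot.
Variable A : operator H.
Hypothesis A_self_adjoint : self_adjoint dot A.
Variable P : H -> H.
Hypothesis P_red : reducing_projection dot A P.
Variable a : R.
Hypothesis op_lower :
  forall x, dom A x -> P x = 0 -> a * `|x| ^+ 2 <= dot (A x) x.

Let P_proj := rp_projection P_red.
Let V := range (fun x => x - P x).
Let VP x : V x <-> P x = 0 := range_compl P_proj x.

Lemma compl_dom x : dom A x -> dom A (x - P x).
Proof. by move=> dx; apply: (domB A_self_adjoint) => //; exact: (rp_dom P_red). Qed.

Lemma op_compl x : dom A x -> A (x - P x) = A x - P (A x).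
Proof.
move=> dx; rewrite (opB A_self_adjoint)//; last exact: (rp_dom P_red).
by rewrite (rp_comm P_red).
Qed.

Lemma op_shiftB l x y : dom A x -> dom A y ->
  A (x - y) - l *: (x - y) = (A x - l *: x) - (A y - l *: y).
Proof.
move=> dx dy; rewrite (opB A_self_adjoint)// scalerBr !opprB addrACA [RHS]addrACA.
by congr (_ + _); rewrite addrC.
Qed.

Lemma op_coercive l x : dom A x -> P x = 0 ->
  (a - l) * `|x| <= `|A x - l *: x|.
Proof.
move=> dx Px; have [->|x0] := eqVneq x 0; first by rewrite normr0 mulr0.
have xp : 0 < `|x| by rewrite normr_gt0.
rewrite -(ler_pM2r xp); apply: le_trans (dot_le norm_dot _ _).
rewrite dotBl dotZl -norm_dot; have := op_lower dx Px; nra.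
Qed.

(** Coercivity and closedness of [A] make the range of [A - l] on the complement closed. A vector of
    the complement orthogonal to that range is, by self-adjointness, an eigenvector for [l < a]
    unless it vanishes, and the lower bound on the form makes it vanish. *)
Lemma op_surjective l y : l < a -> P y = 0 ->
  exists x, [/\ P x = 0, dom A x & A x - l *: x = y].
Proof.
move=> la Py; have al0 : 0 < a - l by rewrite subr_gt0.
pose W := [set A x - l *: x | x in [set x | P x = 0 /\ dom A x]].
have lW (c : R) u v : W u -> W v -> W (c *: u + v).
  move=> [x [Px dx] <-] [z [Pz dz] <-]; exists (c *: x + z).
    split; first by rewrite (projD P_proj) (projZ P_proj) Px Pz scaler0 addr0.
    by have [] := op_comb A_self_adjoint c dx dz.
  have [_ ->] := op_comb A_self_adjoint c dx dz.
  by rewrite scalerDr scalerBr !scalerA mulrC opprD addrACA.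
have W0 : W 0.
  exists 0; last by rewrite (op0 A_self_adjoint) scaler0 subr0.
  by split; [exact: (proj0 P_proj)|exact: (dom0 A_self_adjoint)].
have PA x : dom A x -> P x = 0 -> P (A x - l *: x) = 0.
  move=> dx Px; rewrite (projB P_proj) (projZ P_proj) Px scaler0 subr0.
  by rewrite -(rp_comm P_red)// Px (op0 A_self_adjoint).
have cW : closed W.
  move=> w clw.
  have /choice[x hx] : forall n : nat, exists x,
      [/\ P x = 0, dom A x & `|w - (A x - l *: x)| < n.+1%:R^-1].
    move=> n; have e0 : 0 < n.+1%:R^-1 :> R by rewrite invr_gt0.
    have [_ [[x [Px dx] <-] xw]] := clw _ (nbhsx_ballx w _ e0).
    by exists x; split=> //; move: xw; rewrite -ball_normE.
  have Px n : P (x n) = 0 by have [] := hx n.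
  have dx n : dom A (x n) by have [] := hx n.
  have Bx : (fun n => A (x n) - l *: x n) @ \oo --> w.
    apply/cvgrPdist_lt => e e0.
    have [N _ hN] := near_infty_natSinv_lt (PosNum e0).
    by exists N => // n Nn; have [_ _ h] := hx n; apply: lt_trans h _; exact: hN.
  have /cvg_ex[z xz] : cvgn x.
    apply: cvg_of_cauchy => e e0.
    have ae0 : 0 < (a - l) * e / 2 by rewrite divr_gt0// mulr_gt0.
    have [N _ hN] := near_infty_natSinv_lt (PosNum ae0).
    exists N => n k Nn Nk; rewrite -(ler_pM2l al0).
    have [_ _ hn] := hx n; have [_ _ hk] := hx k.
    apply: le_trans (op_coercive l (domB A_self_adjoint (dx n) (dx k)) _) _.
      by rewrite (projB P_proj) !Px subrr.
    have -> : A (x n - x k) - l *: (x n - x k) =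
        (w - (A (x k) - l *: x k)) - (w - (A (x n) - l *: x n)).
      rewrite op_shiftB//; move: (A (x n) - _) (A (x k) - _) => u v.
      by rewrite (opprB w u) [RHS]addrC addrA subrK.
    apply: le_trans (ler_normB _ _) _.
    rewrite [X in _ <= X]splitr lerD// ltW//.
      exact: (lt_trans hk (hN _ Nk)).
    exact: (lt_trans hn (hN _ Nn)).
  have Ax : A \o x @ \oo --> w + l *: z.
    have -> : A \o x = (fun n => (A (x n) - l *: x n) + l *: x n).
      by apply/funext => n /=; rewrite subrK.
    by apply: cvgD => //; apply: cvgZr.
  have [dz Az] := op_closed norm_dot A_self_adjoint dx xz Ax.
  exists z; last by rewrite Az addrK.
  split=> //; apply: (dot_inj norm_dot) => y'; rewrite dot0l (proj_sym P_proj).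
  have h : (fun n => dot (P y') (x n)) @ \oo --> dot (P y') z.
    exact: cvg_dotr.
  rewrite (_ : (fun n => _) = cst 0) in h.
    rewrite dotC; apply: (cvg_unique (@Rhausdorff R) h); exact: cvg_cst.
  by apply/funext => n; rewrite (proj_ortho P_proj).
have [v [x [Px dx] xv] hv] := orthogonal_decomposition norm_dot y cW W0 lW.
exists x; split=> //; apply/esym/subr0_eq; rewrite xv; move: hv.
have Pz : P (y - v) = 0 by rewrite (projB P_proj) Py -xv PA// subrr.
move: (y - v) Pz => z Pz hz.
(* Orthogonality is known only against vectors [u - P u], but [P z = 0] removes the contribution of
   [P u]; this places [z] in the domain of the adjoint. *)
have [dz Az] : dom A z /\ A z = l *: z.
  apply: (adjointP A_self_adjoint) => u du.
  have : dot z (A (u - P u) - l *: (u - P u)) = 0.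
    apply: hz; exists (u - P u) => //; split; last exact: compl_dom.
    exact: (proj_compl P_proj).
  have symP w : dot z (P w) = 0 by rewrite -(proj_sym P_proj) Pz dot0l.
  rewrite op_compl// dotBr dotZr !dotBr !symP !subr0 dotZr => /eqP.
  by rewrite subr_eq0 dotC => /eqP ->; rewrite dotC.
have := op_lower dz Pz; rewrite Az dotZl -norm_dot => h.
have : (a - l) * `|z| ^+ 2 <= 0 by lra.
rewrite pmulr_rle0// => h0.
by apply/eqP; rewrite -normr_eq0 -sqrf_eq0 eq_le h0 sqr_ge0.
Qed.

Lemma resolvent_below l : l < a -> exists G, is_resolvent V A l G.
Proof.
move=> la; have al0 : 0 < a - l by rewrite subr_gt0.
have /choice[G hG] : forall y, exists x, P y = 0 ->
    [/\ P x = 0, dom A x & A x - l *: x = y].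
  move=> y; have [Py|nPy] := pselect (P y = 0).
    by have [x ?] := op_surjective la Py; exists x.
  by exists 0.
have PA x : dom A x -> P x = 0 -> P (A x - l *: x) = 0.
  move=> dx Px; rewrite (projB P_proj) (projZ P_proj) Px scaler0 subr0.
  by rewrite -(rp_comm P_red)// Px (op0 A_self_adjoint).
exists G; split.
- by move=> y /VP Py; have [Gy dG AG] := hG _ Py; split => //; apply/VP.
- move=> x /VP Px dx.
  have [Gx dG AG] := hG _ (PA _ dx Px).
  set g := G _ in Gx dG AG *.
  have Pgx : P (g - x) = 0 by rewrite (projB P_proj) Gx Px subrr.
  have := op_coercive l (domB A_self_adjoint dG dx) Pgx.
  have -> : A (g - x) - l *: (g - x) = (A g - l *: g) - (A x - l *: x).
    exact: op_shiftB.
  rewrite AG subrr normr0.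
  rewrite pmulr_rle0// normr_le0 subr_eq0 => /eqP //.
- exists (a - l)^-1 => y /VP Py; have [Gy dG AG] := hG _ Py.
  by have := op_coercive l dG Gy; rewrite AG ler_pdivlMl.
Qed.

Hypothesis compl_neq0 : exists x, P x != x.

(** If [1 - P] vanished on [dom A], then every [x - P x] would be orthogonal to the dense domain,
    hence zero. *)
Lemma exists_unit : exists x, [/\ dom A x, P x = 0 & `|x| = 1].
Proof.
have [x [dx Px x0]] : exists x, [/\ dom A x, P x = 0 & x != 0].
  apply: contrapT => h; have [x] := compl_neq0; rewrite -subr_eq0 -oppr_eq0 opprB.
  move=> /eqP; apply; apply: (dom_total norm_dot A_self_adjoint) => y dy.
  have [_ _ symQ] := compl_orthogonal_projection P_proj.
  rewrite symQ; suff -> : y - P y = 0 by rewrite dot0r.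
  apply: contrapT => /eqP yPy; apply: h; exists (y - P y); split => //.
    exact: compl_dom.
  exact: (proj_compl P_proj).
exists (`|x|^-1 *: x); split.
- exact: (domZ A_self_adjoint).
- by rewrite (projZ P_proj) Px scaler0.
- by rewrite normrZ normfV normr_id mulVf// normr_eq0.
Qed.

(** The numerical range of [A] on the kernel of [P]. *)
Let N := [set dot (A x) x | x in [set x | [/\ dom A x, P x = 0 & `|x| = 1]]].

Let lbN : lbound N a.
Proof.
by move=> _ [x [dx Px x1] <-]; have := op_lower dx Px; rewrite x1 expr1n mulr1.
Qed.

Let N_neq0 : N !=set0.
Proof. by have [x hx] := exists_unit; exists (dot (A x) x); exists x. Qed.

Lemma inf_numerical_range_le x : dom A x -> P x = 0 ->
  inf N * `|x| ^+ 2 <= dot (A x) x.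
Proof.
move=> dx Px; have [->|x0] := eqVneq x 0.
  by rewrite normr0 expr0n mulr0 (op0 A_self_adjoint) dot0l.
have xp : 0 < `|x| by rewrite normr_gt0.
rewrite -ler_pdivlMr ?exprn_gt0//; apply: ge_inf; first by exists a.
exists (`|x|^-1 *: x).
  split; first exact: (domZ A_self_adjoint).
  - by rewrite (projZ P_proj) Px scaler0.
  - by rewrite normrZ normfV normr_id mulVf// normr_eq0.
by rewrite (opZ A_self_adjoint)// dotZl dotZr mulrA mulrC -invfM -expr2.
Qed.

(** Let [G] be a bounded inverse of [A - l] at the infimum [l]. Cauchy-Schwarz for the form of
    [A - l], at [G x] and a unit vector [x], gives [1 <= <x, G x> <(A - l) x, x>]. The first factor
    is bounded, while the second is arbitrarily small for near-minimizers. *)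
Lemma inf_numerical_range_spectrum : spectrum_on V A (inf N).
Proof.
case=> G [GV Gl [C GC]]; set l := inf N in GV Gl.
pose K := Num.max C 1; have K0 : 0 < K by rewrite lt_max ltr01 orbT.
have hN : has_inf N by split => //; exists a.
have Kinv : 0 < K^-1 by rewrite invr_gt0.
have [_ [x [dx Px x1] <-]] := inf_adherent Kinv hN; rewrite -/l => hx.
have [/VP PG dG AG] := GV _ ((VP x).2 Px).
have := op_cauchy_schwarz A_self_adjoint (l := l) dG dx.
rewrite AG -norm_dot x1 !expr1n => /(_ _) h.
have {h} : 1 <= dot x (G x) * dot (A x - l *: x) x.
  apply: h => s.
  have dGs : dom A (G x + s *: x).
    by apply: (domD A_self_adjoint) => //; exact: (domZ A_self_adjoint).
  have PGs : P (G x + s *: x) = 0.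
    by rewrite (projD P_proj) (projZ P_proj) PG Px scaler0 addr0.
  by rewrite dotBl dotZl -norm_dot subr_ge0; exact: inf_numerical_range_le.
apply/negP; rewrite -ltNge dotBl dotZl -norm_dot x1 expr1n mulr1.
have b0 : 0 <= dot (A x) x - l.
  by rewrite subr_ge0; have := inf_numerical_range_le dx Px; rewrite x1 expr1n mulr1.
have b1 : dot (A x) x - l < K^-1 by rewrite ltrBlDl.
apply: (@le_lt_trans _ _ (K * (dot (A x) x - l))).
  apply: ler_wpM2r => //; apply: le_trans (dot_le norm_dot _ _) _.
  rewrite x1 mul1r; apply: le_trans (GC _ ((VP x).2 Px)) _.
  by rewrite x1 mulr1 le_max lexx.
by rewrite -ltr_pdivlMl// mulr1.
Qed.

Let lb_spectrum : lbound (spectrum_on V A) a.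
Proof. by move=> l hl; rewrite leNgt; apply/negP => /resolvent_below. Qed.

Lemma bottom_ge : a <= inf (spectrum_on V A).
Proof.
by apply: lb_le_inf => //; exists (inf N); exact: inf_numerical_range_spectrum.
Qed.

(** Upgrades the crude bound [a] to the exact bottom of the spectrum, the rate appearing in the
    tracking estimate. *)
Lemma bottom_le x : dom A x -> P x = 0 ->
  inf (spectrum_on V A) * `|x| ^+ 2 <= dot (A x) x.
Proof.
move=> dx Px; apply: le_trans (inf_numerical_range_le dx Px).
rewrite ler_wpM2r ?sqr_ge0//; apply: ge_inf; first by exists a.
exact: inf_numerical_range_spectrum.
Qed.

End BottomOfSpectrum.

(** * Right derivatives *)

(** One-sided because the generator is a limit at [0^'+] and the restart formula only describes
    forward increments. *)
Definition rderiv {R : realType} {V : normedModType R} (f : R -> V) (t : R)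
    (l : V) :=
  (fun h => h^-1 *: (f (t + h) - f t)) @ 0^'+ --> l.

Section RightDerivative.
Context {R : realType} {V : normedModType R}.
Implicit Types (f g : R -> V) (t : R).

Lemma is_derive_rderiv f t l : is_derive t (1 : R) f l -> rderiv f t l.
Proof.
move=> fl; have [df fE] := fl; rewrite /rderiv -fE.
have -> : (fun h : R => h^-1 *: (f (t + h) - f t)) =
    (fun h : R => h^-1 *: ((f \o shift t) (h *: (1 : R)) - f t)).
  by apply/funext => h /=; rewrite /GRing.scale/= mulr1 (addrC h).
exact: cvg_dnbhs_at_right.
Qed.

Lemma rderiv_cvg f t l : rderiv f t l -> (fun h => f (t + h)) @ 0^'+ --> f t.
Proof.
move=> fl.
have h1 : (fun h : R => f t + h *: (h^-1 *: (f (t + h) - f t))) @ 0^'+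
    --> f t + 0 *: l.
  apply: cvgD; first exact: cvg_cst.
  by apply: cvgZ fl; apply: cvg_at_right_filter; exact: cvg_id.
rewrite scale0r addr0 in h1; apply: cvg_trans h1; apply: near_eq_cvg.
near=> h.
have h0 : h != 0 by rewrite gt_eqF//; near: h; exact: nbhs_right_gt.
by rewrite scalerA divff// scale1r addrC subrK.
Unshelve. all: by end_near. Qed.

Lemma rderivB f g t a b : rderiv f t a -> rderiv g t b ->
  rderiv (fun s => f s - g s) t (a - b).
Proof.
move=> fa gb; rewrite /rderiv.
have -> : (fun h : R => h^-1 *: (f (t + h) - g (t + h) - (f t - g t))) =
    (fun h => h^-1 *: (f (t + h) - f t) - h^-1 *: (g (t + h) - g t)).
  apply/funext => h; rewrite -scalerBr; congr (_ *: _).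
  by rewrite !opprB addrACA [RHS]addrACA; congr (_ + _); rewrite addrC.
exact: cvgB.
Qed.

End RightDerivative.

Section RightDerivativeProduct.
Context {R : realType} {H : completeNormedModType R}.
Variable dot : {dot H for idfun}.
Hypothesis norm_dot : hilbert_norm dot.

Lemma rderiv_dot (f g : R -> H) t a b : rderiv f t a -> rderiv g t b ->
  rderiv (fun s => dot (f s) (g s)) t (dot a (g t) + dot (f t) b).
Proof.
move=> fa gb; rewrite /rderiv.
have -> : (fun h : R => h^-1 *: (dot (f (t + h)) (g (t + h)) - dot (f t) (g t))) =
    (fun h => dot (h^-1 *: (f (t + h) - f t)) (g (t + h)) +
              dot (f t) (h^-1 *: (g (t + h) - g t))).
  apply/funext => h; rewrite dotZl dotZr dotBl dotBr -mulrDr.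
  by congr (_ * _); ring.
apply: cvgD.
  by apply: cvg_dot => //; exact: rderiv_cvg gb.
by apply: cvg_dot => //; exact: cvg_cst.
Qed.

Lemma rderivM (f g : R -> R) t a b : rderiv f t a -> rderiv g t b ->
  rderiv (fun s => f s * g s) t (a * g t + f t * b).
Proof.
move=> fa gb; rewrite /rderiv.
have -> : (fun h : R => h^-1 *: (f (t + h) * g (t + h) - f t * g t)) =
    (fun h => (h^-1 *: (f (t + h) - f t)) * g (t + h) +
              f t * (h^-1 *: (g (t + h) - g t))).
  by apply/funext => h; rewrite /GRing.scale/=; ring.
apply: cvgD.
  by apply: cvgM => //; exact: rderiv_cvg gb.
by apply: cvgM => //; exact: cvg_cst.
Qed.

End RightDerivativeProduct.

(** * First crossing and monotonicity from right derivatives *)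

Section Crossing.
Context {R : realType}.

Lemma rderiv_lt0_le0 (phi : R -> R) t d : rderiv phi t d -> d < 0 -> phi t = 0 ->
  \forall h \near 0^'+, phi (t + h) <= 0.
Proof.
move=> /cvgrPdist_lt hd d0 pt; have d0' : 0 < - d by rewrite oppr_gt0.
near=> h; have h0 : 0 < h by near: h; exact: nbhs_right_gt.
have : `|d - h^-1 *: (phi (t + h) - phi t)| < - d by near: h; exact: hd.
rewrite pt subr0 ltr_norml opprK => /andP[+ _].
by rewrite ltrDl oppr_gt0 /GRing.scale/= pmulr_rlt0 ?invr_gt0// => /ltW.
Unshelve. all: by end_near. Qed.

(** Let [s] be the infimum of the times where [phi > 0]. Continuity gives [phi s <= 0]. Right after
    [s] the sign stays nonpositive, by the hypothesis if [phi s = 0] and by continuity otherwise, so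
    the infimum would be larger. The hypothesis concerns zeros only and accepts finite increments,
    so it also serves functions without a derivative. *)
Lemma crossing (phi : R -> R) (b : R) : 0 <= b ->
  {within `[0, b]%classic, continuous phi} -> phi 0 < 0 ->
  (forall t, 0 < t < b -> phi t = 0 -> \forall h \near 0^'+, phi (t + h) <= 0) ->
  phi b <= 0.
Proof.
move=> b0 /subspace_continuousP cphi phi0 hcross.
rewrite leNgt; apply/negP => phib.
pose D := [set s : R | 0 <= s <= b /\ 0 < phi s].
have hD : has_inf D.
  by split; [exists b; split; rewrite ?b0 ?lexx|exists 0 => s [/andP[]]].
pose s := inf D.
have s0 : 0 <= s by apply: lb_le_inf; [exact: hD.1|move=> r [/andP[]]].
have sb : s <= b by apply: ge_inf; [exact: hD.2|split; rewrite ?b0 ?lexx].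
have Is : `[0, b]%classic s by rewrite /= in_itv/= s0.
have ltsD r : 0 <= r -> r < s -> phi r <= 0.
  move=> r0 rs; rewrite leNgt; apply/negP => pr.
  have : s <= r.
    by apply: ge_inf; [exact: hD.2|split; rewrite ?r0 ?(ltW (lt_le_trans rs sb))].
  by rewrite leNgt rs.
have phis : phi s <= 0.
  rewrite leNgt; apply/negP => ps.
  have sp : 0 < s.
    rewrite lt_neqAle s0 andbT; apply/eqP => s0'.
    by move: ps; rewrite -s0' ltNge (ltW phi0).
  have /cvgrPdist_lt/(_ _ ps) := cphi _ Is.
  rewrite near_withinE => /nbhs_ballP[e /= e0 he].
  pose r := Num.max 0 (s - e / 2).
  have r0 : 0 <= r by rewrite le_max lexx.
  have rs : r < s by rewrite gt_max sp /= ltrBlDr ltrDl divr_gt0.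
  have := he r; rewrite /ball/= => /(_ _ _) h.
  have : `|phi s - phi r| < phi s.
    apply: h => /=; last by rewrite in_itv/= r0 (ltW (lt_le_trans rs sb)).
    rewrite gtr0_norm ?subr_gt0// ltrBlDl -ltrBlDr.
    rewrite lt_max; apply/orP; right.
    by rewrite ltrD2l ltrN2 ltr_pdivrMr// ltr_pMr// ltr1n.
  move=> /(le_lt_trans (ler_norm _)); rewrite ltrBlDr ltrDl.
  by rewrite ltNge (ltsD _ r0 rs).
have [e e0 he] : exists2 e, 0 < e &
    forall h, 0 < h -> h < e -> s + h <= b -> phi (s + h) <= 0.
  move: phis; rewrite le_eqVlt => /predU1P[ps|ps].
    have sp : 0 < s.
      rewrite lt_neqAle s0 andbT; apply/eqP => s0'.
      by move: phi0; rewrite [X in phi X]s0' ps ltxx.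
    have slb : s < b.
      rewrite lt_neqAle sb andbT; apply/eqP => s0'; move: phib.
      by rewrite -s0' ps ltxx.
    have := hcross s _ ps; rewrite sp slb near_withinE => /(_ isT).
    move=> /nbhs_ballP[e /= e0 he]; exists e => // h h0 lhe _.
    by apply: he => //; rewrite /ball/= sub0r normrN gtr0_norm.
  have /cvgrPdist_lt/(_ (- phi s)) := cphi _ Is.
  rewrite oppr_gt0 near_withinE => /(_ ps)/nbhs_ballP[e /= e0 he].
  exists e => // h h0 lhe shb.
  have := he (s + h); rewrite /ball/= opprD addNKr normrN gtr0_norm//.
  move=> /(_ lhe); rewrite in_itv/= shb addr_ge0// ?(ltW h0)// => /(_ isT).
  by rewrite ltr_norml opprK => /andP[+ _]; rewrite ltrDl oppr_gt0 => /ltW.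
have : s + e / 2 <= s.
  apply: lb_le_inf; first exact: hD.1.
  move=> r Dr; have sr : s <= r by apply: ge_inf => //; exact: hD.2.
  have [/andP[r0 rb] pr] := Dr.
  rewrite leNgt; apply/negP => rse.
  have := he (r - s); rewrite subrKC rb.
  have [rs|] := eqVneq r s; first by move: pr; rewrite rs ltNge phis.
  move=> rs; rewrite subr_gt0 lt_neqAle eq_sym rs sr => /(_ isT) h.
  suff : phi r <= 0 by rewrite leNgt pr.
  apply: h => //; rewrite ltrBlDl (lt_trans rse)// ltrD2l.
  by rewrite ltr_pdivrMr// ltr_pMr// ltr1n.
by rewrite gerDl leNgt divr_gt0.
Qed.

Lemma rderiv_le0 (g g' : R -> R) (b : R) : 0 <= b ->
  {within `[0, b]%classic, continuous g} ->
  (forall t, 0 <= t -> t < b -> rderiv g t (g' t)) ->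
  (forall t, 0 <= t -> t < b -> g' t <= 0) -> g b <= g 0.
Proof.
move=> b0 cg dg g'0; apply/ler_addgt0Pr => k k0.
have b1 : 0 < b + 1 by rewrite ltr_wpDl.
pose q := k / (b + 1); have q0 : 0 < q by rewrite divr_gt0.
(* The constant part makes [phi 0] strictly negative, the slope makes the derivative strictly
   negative, and the total slack at [b] is exactly [k]. *)
pose phi s := g s - (g 0 + q * (1 + s)).
suff : phi b <= 0.
  by rewrite subr_le0 (addrC 1) /q divfK// gt_eqF.
have crx x : (fun s => g 0 + q * (1 + s)) @ x --> g 0 + q * (1 + x).
  apply: cvgD; first exact: cvg_cst.
  by apply: cvgM; [exact: cvg_cst|apply: cvgD; [exact: cvg_cst|exact: cvg_id]].
apply: crossing => //.
- move/subspace_continuousP : cg => cg.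
  apply/subspace_continuousP => x Ix; apply: cvgB; first exact: cg.
  by apply: cvg_within_filter; exact: crx.
- by rewrite /phi addr0 mulr1 opprD addrA subrr sub0r oppr_lt0.
- move=> t /andP[t0 tb]; apply: (@rderiv_lt0_le0 _ _ (g' t - q)).
    apply: rderivB; first exact: dg (ltW t0) tb.
    rewrite /rderiv; apply: (@cvg_trans _ (cst q @ 0^'+)); last exact: cvg_cst.
    apply: near_eq_cvg; near=> h.
    have h0 : h != 0 by rewrite gt_eqF//; near: h; exact: nbhs_right_gt.
    by rewrite /GRing.scale/=; field.
  by rewrite subr_lt0 (le_lt_trans (g'0 _ (ltW t0) tb)).
Unshelve. all: by end_near. Qed.

End Crossing.

Lemma within_ray_cvg {R : realType} {V : topologicalType} (v : R -> V) (b x : R) :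
  {within `[0, +oo[%classic, continuous v} -> `[0, b]%classic x ->
  v @ within `[0, b]%classic (nbhs x) --> v x.
Proof.
move=> cv Ix.
have cvb : {within `[0, b]%classic, continuous v}.
  apply: continuous_subspaceW cv => y /=.
  by rewrite !in_itv/= andbT => /andP[].
by move/subspace_continuousP : cvb; apply.
Qed.

(** * Energy decay along solutions of the linear equation *)

Section Energy.
Context {R : realType} {H : completeNormedModType R}.
Variable dot : {dot H for idfun}.
Hypothesis norm_dot : hilbert_norm dot.
Variable A : operator H.

Lemma rderiv_expR (c t : R) : rderiv (fun s => expR (c * s)) t (c * expR (c * t)).
Proof.
apply: is_derive_rderiv.
have h : is_derive t (1 : R) (fun s : R => c * s) c.
  have := is_deriveZ c (is_derive_id t (1 : R)).
  by rewrite /GRing.scale/= mulr1.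
by rewrite mulrC; exact: (is_derive1_comp (is_derive_expR (c * t)) h).
Qed.

Lemma continuous_expRM (c : R) : continuous (fun s : R => expR (c * s)).
Proof.
move=> x; apply: continuous_comp; last exact: continuous_expR.
by apply: cvgM; [exact: cvg_cst|exact: cvg_id].
Qed.

Lemma norm_rderiv (v : R -> H) (t : R) v' : rderiv v t v' ->
  rderiv (fun s => `|v s| ^+ 2) t (2 * dot v' (v t)).
Proof.
move=> dv; have := rderiv_dot norm_dot dv dv.
rewrite (_ : (fun s => dot (v s) (v s)) = (fun s => `|v s| ^+ 2)); last first.
  by apply/funext => s; rewrite norm_dot.
by rewrite (dotC _ (v t)); congr rderiv; ring.
Qed.

(** The function [expR (2 l s) |v s|^2] has nonpositive right derivative. The curve [v] is
    arbitrary, so the lemma also gives uniqueness: with [v 0 = 0] and [l = 0] it forces [v = 0]. *)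
Lemma energy_decay (l : R) (v : R -> H) (b : R) : 0 <= b ->
  {within `[0, +oo[%classic, continuous v} ->
  (forall t, 0 <= t -> rderiv v t (- A (v t))) ->
  (forall t, 0 <= t -> l * `|v t| ^+ 2 <= dot (A (v t)) (v t)) ->
  `|v b| <= expR (- l * b) * `|v 0|.
Proof.
move=> b0 cv dv lv.
pose g s := expR (2 * l * s) * `|v s| ^+ 2.
have : g b <= g 0.
  apply: (@rderiv_le0 _ _ (fun t => 2 * l * expR (2 * l * t) * `|v t| ^+ 2
      + expR (2 * l * t) * (2 * dot (- A (v t)) (v t)))) => //.
  - apply/subspace_continuousP => x Ix.
    apply: cvgM; first by apply: cvg_within_filter; exact: continuous_expRM.
    have vx := within_ray_cvg cv Ix.
    rewrite (_ : (fun y => `|v y| ^+ 2) = (fun y => dot (v y) (v y))).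
      by rewrite norm_dot; exact: cvg_dot.
    by apply/funext => s; rewrite norm_dot.
  - by move=> t t0 _; apply: rderivM; [exact: rderiv_expR|exact/norm_rderiv/dv].
  - move=> t t0 _; rewrite dotNl.
    have := lv _ t0; have := expR_gt0 (2 * l * t); nra.
rewrite /g mulr0 expR0 mul1r => h.
rewrite -ler_sqr ?nnegrE ?mulr_ge0 ?expR_ge0// exprMn -expRM_natl.
rewrite -ler_pdivrMl ?expR_gt0// -expRN; apply: le_trans h.
by rewrite (_ : - _ = 2 * l * b)//; ring.
Qed.

End Energy.

(** * The semigroup *)

Section Semigroup.
Context {R : realType} {H : completeNormedModType R}.
Variable dot : {dot H for idfun}.
Hypothesis norm_dot : hilbert_norm dot.
Variable A : operator H.
Hypothesis A_self_adjoint : self_adjoint dot A.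
Hypothesis A_nonneg : nonnegative dot A.
Variable T : R -> H -> H.
Hypothesis T_C0 : C0_semigroup T.
Hypothesis T_gen : generated_by_opp A T.

Lemma sgZD t (a : R) x y : 0 <= t -> T t (a *: x + y) = a *: T t x + T t y.
Proof. by case: T_C0 => lT _ _ _ /lT[]. Qed.

Lemma sgD t x y : 0 <= t -> T t (x + y) = T t x + T t y.
Proof. by move=> /(@sgZD t 1 x y); rewrite !scale1r. Qed.

Lemma sgv0 t : 0 <= t -> T t 0 = 0.
Proof. by move=> t0; apply: (@addrI _ (T t 0)); rewrite -sgD// !addr0. Qed.

Lemma sgZ t a x : 0 <= t -> T t (a *: x) = a *: T t x.
Proof. by move=> t0; have := sgZD a x 0 t0; rewrite sgv0// !addr0. Qed.

Lemma sgN t x : 0 <= t -> T t (- x) = - T t x.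
Proof. by move=> t0; rewrite -scaleN1r sgZ// scaleN1r. Qed.

Lemma sgB t x y : 0 <= t -> T t (x - y) = T t x - T t y.
Proof. by move=> t0; rewrite sgD// sgN. Qed.

Lemma sg_continuous t : 0 <= t -> continuous (T t).
Proof. by case: T_C0 => lT _ _ _ /lT[]. Qed.

Lemma sg0 x : T 0 x = x.
Proof. by case: T_C0. Qed.

Lemma sg_add s t x : 0 <= s -> 0 <= t -> T (s + t) x = T s (T t x).
Proof. by case: T_C0 => _ _ + _; exact. Qed.

Lemma sg_right0 x : T t x @[t --> 0^'+] --> x.
Proof. by case: T_C0. Qed.

Lemma sg_dist_small (x : H) (e : R) : 0 < e ->
  exists2 d, 0 < d & forall t, 0 <= t -> t < d -> `|x - T t x| < e.
Proof.
move=> e0; have /cvgrPdist_lt/(_ _ e0) := @sg_right0 x.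
rewrite near_withinE => /nbhs_ballP[d /= d0 hd]; exists d => // t.
rewrite le_eqVlt => /predU1P[<- _|t0 td]; first by rewrite sg0 subrr normr0.
by apply: hd => //; rewrite /ball/= sub0r normrN gtr0_norm.
Qed.

Lemma sg_bounded t : 0 <= t -> bounded_fun_norm (T t).
Proof.
move=> t0 r.
have /cvgrPdist_lt/(_ _ ltr01) := @sg_continuous t t0 (0 : H).
move=> /nbhs_ballP[d /= d0 hd].
have r1 : 0 < `|r| + 1 by rewrite ltr_wpDl.
(* Scaling by [c] brings vectors of norm at most [r] into the ball that [T t] maps into the unit
   ball. *)
pose c := d / (`|r| + 1); have c0 : 0 < c by rewrite divr_gt0.
have cr : c * r < d.
  rewrite /c mulrAC ltr_pdivrMr// ltr_pM2l//.
  by rewrite (le_lt_trans (ler_norm r))// ltrDl.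
move: c c0 cr => c c0 cr; exists c^-1 => x xr.
have := hd (c *: x); rewrite -ball_normE /ball_/= sub0r normrN.
rewrite sgv0// sub0r normrN sgZ// !normrZ gtr0_norm// => h.
rewrite -[leRHS]mulr1 ler_pdivlMl//; apply/ltW/h.
by apply: le_lt_trans cr; rewrite ler_pM2l.
Qed.

(* By Banach-Steinhaus, along a sequence of times tending to [0]. *)
Lemma sg_local_bound : exists d C : R, [/\ 0 < d, 0 < C &
  forall t x, 0 <= t -> t <= d -> `|T t x| <= C * `|x|].
Proof.
apply: contrapT => nb.
have /choice[s hs] : forall n : nat, exists s : R * H,
    [/\ 0 <= s.1, s.1 <= n.+1%:R^-1 & n.+1%:R * `|s.2| < `|T s.1 s.2| ].
  move=> n; apply: contrapT => hn; apply: nb; exists n.+1%:R^-1, n.+1%:R.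
  split; rewrite ?invr_gt0// => t x t0 tn; rewrite leNgt; apply/negP => h.
  by apply: hn; exists (t, x).
pose F := [set T (s n).1 | n in [set: nat]].
have Flin f : F f -> bounded_fun_norm f /\ linear f.
  move=> [n _ <-]; have [s0 _ _] := hs n; split; last by move=> a x y; exact: sgZD.
  exact: sg_bounded.
have Fpt : pointwise_bounded F.
  move=> x.
  have cT : (fun n => T (s n).1 x) @ \oo --> x.
    apply/cvgrPdist_lt => e /(sg_dist_small x)[d d0 hd].
    have [N _ hN] := near_infty_natSinv_lt (PosNum d0).
    exists N => // n Nn; have [s0 sn _] := hs n; apply: hd => //.
    exact: le_lt_trans sn (hN _ Nn).
  have [M [_ hM]] := cvg_seq_bounded (cvgP _ cT).
  exists (M + 1) => _ [n _ <-]; apply: (hM (M + 1)) => //.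
  by rewrite ltrDl.
have [M hM] := Banach_Steinhauss Flin Fpt 1.
pose n := Num.bound `|M|.
have Mn : M < n.+1%:R.
  apply: le_lt_trans (ler_norm _) _.
  by rewrite (lt_trans (archi_boundP (normr_ge0 _)))// ltr_nat.
have [s0 sn] := hs n; set x := (s n).2 => hn.
have x0 : x != 0.
  by apply/eqP => x0; move: hn; rewrite x0 sgv0// normr0 mulr0 ltxx.
have xp : 0 < `|x| by rewrite normr_gt0.
have := hM (T (s n).1) (ex_intro2 _ _ n I erefl) (`|x|^-1 *: x).
rewrite normrZ normfV normr_id mulVf ?gt_eqF// lexx sgZ// normrZ normfV normr_id.
rewrite ler_pdivrMl// => /(_ isT) h.
have := lt_le_trans hn h; rewrite mulrC ltr_pM2l// => /lt_trans/(_ Mn).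
by rewrite ltxx.
Qed.

Lemma sg_bound b : exists2 C : R, 0 < C &
  forall t x, 0 <= t -> t <= b -> `|T t x| <= C * `|x|.
Proof.
have [d [C [d0 C0 hC]]] := sg_local_bound.
have hn n : exists2 K : R, 0 < K &
    forall t x, 0 <= t -> t <= n%:R * d -> `|T t x| <= K * `|x|.
  elim: n => [|n [K K0 hK]].
    exists 1 => // t x t0; rewrite mul0r mul1r => t0'.
    by rewrite (@le_anti _ _ t 0) ?t0 ?t0'// sg0.
  (* The summand [K] covers the times already treated, since [C] may be smaller than [1]. *)
  exists (K * C + K) => [|t x t0 tn]; first by rewrite addr_gt0// mulr_gt0.
  have [tn'|tn'] := leP t (n%:R * d).
    by apply: le_trans (hK _ _ t0 tn') _; rewrite ler_wpM2r// lerDr mulr_ge0 ?ltW.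
  have td : 0 <= t - n%:R * d by rewrite subr_ge0 ltW.
  have nd : 0 <= n%:R * d by rewrite mulr_ge0// ltW.
  rewrite -(subrK (n%:R * d) t) addrC sg_add//.
  apply: le_trans (hK _ _ nd (lexx _)) _.
  rewrite mulrDl -mulrA; apply: (@le_trans _ _ (K * (C * `|x|))); last first.
    by rewrite lerDl mulr_ge0// ltW.
  rewrite ler_pM2l//; apply: hC => //.
  by move: tn; rewrite -natr1 mulrDl mul1r lerBlDl.
pose n := Num.bound `|b / d|.
have bn : b <= n%:R * d.
  rewrite -ler_pdivrMr// ltW//; apply: le_lt_trans (ler_norm _) _.
  exact: archi_boundP.
have [K K0 hK] := hn n; exists K => // t x t0 tb.
exact: hK (le_trans tb bn).
Qed.

Lemma sg_dist (b : R) : exists2 C : R, 0 < C & forall s t x, 0 <= s -> 0 <= t ->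
  s <= b -> t <= b -> `|T s x - T t x| <= C * `|x - T `|s - t| x|.
Proof.
have [C C0 hC] := sg_bound b; exists C => // s t x.
wlog st : s t / s <= t.
  move=> h s0 t0 sb tb; have [|/ltW] := leP s t => st; first exact: h.
  by rewrite distrC (distrC s); exact: h.
move=> s0 t0 sb tb.
have -> : `|s - t| = t - s by rewrite distrC ger0_norm ?subr_ge0.
have -> : T t x = T s (T (t - s) x) by rewrite -sg_add ?subr_ge0// addrC subrK.
by rewrite -sgB//; exact: hC.
Qed.

(** Strong continuity is assumed only at [0^'+]; continuity from the left needs uniform bounds on
    compact time intervals. These come from Banach-Steinhaus because the contraction bound is itself
    proved along continuous orbits. *)
Lemma sg_orbit_continuous x :
  {within `[0, +oo[%classic, continuous (fun t => T t x)}.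
Proof.
apply/subspace_continuousP => t /=; rewrite in_itv/= andbT => t0.
have [C C0 hC] := sg_dist (t + 1).
apply/cvgrPdist_lt => e e0.
have eC : 0 < e / C by rewrite divr_gt0.
have [d d0 hd] := sg_dist_small x eC.
rewrite near_withinE; near=> s => /=; rewrite in_itv/= andbT => s0.
have st : `|t - s| < Num.min d 1.
  near: s; apply/nbhs_ballP; exists (Num.min d 1) => //=.
  by rewrite lt_min d0 ltr01.
move: st; rewrite lt_min => /andP[std st1].
apply: le_lt_trans (hC _ _ _ t0 s0 _ _) _; first by rewrite lerDl.
  by move: st1; rewrite distrC ltr_norml => /andP[_]; rewrite ltrBlDl => /ltW.
by rewrite mulrC -ltr_pdivlMr// hd.
Unshelve. all: by end_near. Qed.

Lemma sg_rderiv0 x : dom A x -> t^-1 *: (T t x - x) @[t --> 0^'+] --> - A x.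
Proof. by move=> dx; have [_] := T_gen x (- A x); exact. Qed.

Lemma sg_rderiv t x : 0 <= t -> dom A x ->
  rderiv (fun s => T s x) t (- T t (A x)).
Proof.
move=> t0 dx; rewrite /rderiv -[- T t (A x)]scaleN1r -sgZ// scaleN1r.
have h : (fun h : R => T t (h^-1 *: (T h x - x))) @ 0^'+ --> T t (- A x).
  by apply: continuous_cvg; [exact: sg_continuous|exact: sg_rderiv0].
apply: cvg_trans h; apply: near_eq_cvg; near=> h.
have h0 : 0 <= h by apply: ltW; near: h; exact: nbhs_right_gt.
by rewrite sgZ// sgB// sg_add.
Unshelve. all: by end_near. Qed.

(** The difference quotient at [T t x] is [T t] applied to the quotient at [x]; its limit identifies
    the generator at [T t x]. *)
Lemma sg_domP t x : 0 <= t -> dom A x -> dom A (T t x) /\ A (T t x) = T t (A x).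
Proof.
move=> t0 dx; have [h _] := T_gen (T t x) (- T t (A x)).
have [|d /oppr_inj e] := h; last by split => //; rewrite e.
apply: cvg_trans (sg_rderiv t0 dx); apply: near_eq_cvg; near=> s.
have s0 : 0 <= s by apply: ltW; near: s; exact: nbhs_right_gt.
by rewrite (addrC t s) sg_add.
Unshelve. all: by end_near. Qed.

Lemma sg_dom t x : 0 <= t -> dom A x -> dom A (T t x).
Proof. by move=> t0 /(sg_domP t0)[]. Qed.

Lemma sg_op t x : 0 <= t -> dom A x -> A (T t x) = T t (A x).
Proof. by move=> t0 /(sg_domP t0)[]. Qed.

Lemma sg_rderiv_op t x : 0 <= t -> dom A x ->
  rderiv (fun s => T s x) t (- A (T t x)).
Proof. by move=> t0 dx; rewrite sg_op//; exact: sg_rderiv. Qed.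

(* Extends to all [x] by density of [dom A], through the continuity of [T t]
   and of [x |-> x - P x]. *)
Lemma sg_decay_dense (P : H -> H) (P_proj : orthogonal_projection dot P)
    (P_dom : forall x, dom A x -> dom A (x - P x)) (t K : R) : 0 <= t ->
  (forall x, dom A x -> P x = 0 -> `|T t x| <= K * `|x|) ->
  forall x, P x = 0 -> `|T t x| <= K * `|x|.
Proof.
move=> t0 h x Px; have [u du ux] := dom_seq A_self_adjoint x.
have vx : (fun n => u n - P (u n)) @ \oo --> x.
  by rewrite -[x]subr0 -Px; apply: cvgB => //; exact: cvg_proj.
have Tvx : (fun n => `|T t (u n - P (u n))|) @ \oo --> `|T t x|.
  by apply: cvg_norm; apply: continuous_cvg => //; exact: sg_continuous.
have Kvx : (fun n => K * `|u n - P (u n)|) @ \oo --> K * `|x|.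
  by apply: cvgM; [exact: cvg_cst|exact: cvg_norm].
apply: ler_cvg_to Tvx Kvx _; apply: nearW => n.
by apply: h; [exact: P_dom|exact: (proj_compl P_proj)].
Qed.

(** With this projection the constraint [P x = 0] is void, so the density argument for decay also
    yields the contraction bound on the whole space. *)
Lemma zero_projection : orthogonal_projection dot (fun=> 0).
Proof. by split=> [a x y|//|x y]; rewrite ?scaler0 ?addr0// dot0l dot0r. Qed.

Lemma sg_contract t x : 0 <= t -> `|T t x| <= `|x|.
Proof.
move=> t0; rewrite -[leRHS]mul1r.
apply: (sg_decay_dense zero_projection) => // {}x dx; first by rewrite subr0.
move=> _; have := @energy_decay _ _ _ norm_dot A 0 (fun s => T s x) t t0.
rewrite oppr0 mul0r expR0 sg0; apply.
- exact: sg_orbit_continuous.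
- by move=> s s0; exact: sg_rderiv_op.
- by move=> s s0; rewrite mul0r; apply: A_nonneg; exact: sg_dom.
Qed.

Section Reducing.
Variable P : H -> H.
Hypothesis P_red : reducing_projection dot A P.
Let P_proj := rp_projection P_red.

Lemma cvg_rderiv_proj (v : R -> H) t l : rderiv v t l ->
  rderiv (fun s => P (v s)) t (P l).
Proof.
move=> /(cvg_proj norm_dot P_proj).
rewrite /rderiv.
rewrite (_ : (fun _ => P _) = (fun h => h^-1 *: (P (v (t + h)) - P (v t))))//.
by apply/funext => h; rewrite (projZ P_proj) (projB P_proj).
Qed.

(** For [y] in the domain, the difference of the two sides solves the linear equation with initial
    value [0], so energy decay makes it vanish; density does the rest. *)
Lemma sg_proj t x : 0 <= t -> T t (P x) = P (T t x).
Proof.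
move=> t0; suff h y : dom A y -> T t (P y) = P (T t y).
  have [u du ux] := dom_seq A_self_adjoint x.
  have h1 : (fun n => T t (P (u n))) @ \oo --> T t (P x).
    by apply: continuous_cvg; [exact: sg_continuous|exact: cvg_proj].
  have h2 : (fun n => P (T t (u n))) @ \oo --> P (T t x).
    apply: (cvg_proj norm_dot) => //.
    by apply: continuous_cvg; [exact: sg_continuous|].
  rewrite (_ : (fun n => T t _) = (fun n => P (T t (u n)))) in h1.
    by apply: cvg_unique h1 h2; exact: norm_hausdorff.
  by apply/funext => n; exact: h.
move=> dy.
have := @energy_decay _ _ _ norm_dot A 0 (fun s => T s (P y) - P (T s y)) t t0.
rewrite oppr0 mul0r expR0 !sg0 subrr normr0 mulr0 => h.
apply/subr0_eq/eqP; rewrite -normr_le0; apply: h.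
- apply/subspace_continuousP => s Is; apply: cvgB.
    by have /subspace_continuousP := @sg_orbit_continuous (P y); apply.
  apply: (cvg_proj norm_dot) => //.
  by have /subspace_continuousP := @sg_orbit_continuous y; apply.
- move=> s s0; have dPy := rp_dom P_red y.
  rewrite (opB A_self_adjoint); last 2 first.
  + exact: sg_dom.
  + exact: (rp_dom P_red).
  rewrite opprB addrC -(opprK (A (P _))); apply: rderivB.
    exact: sg_rderiv_op.
  rewrite (rp_comm P_red); last exact: sg_dom.
  by rewrite -(projN P_proj); apply: cvg_rderiv_proj; exact: sg_rderiv_op.
- move=> s s0; rewrite mul0r; apply: A_nonneg.
  apply: (domB A_self_adjoint); last exact: (rp_dom P_red).
  by apply: sg_dom => //; exact: (rp_dom P_red).
Qed.

Lemma sg_decay (l t : R) x :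
  (forall y, dom A y -> P y = 0 -> l * `|y| ^+ 2 <= dot (A y) y) ->
  0 <= t -> P x = 0 -> `|T t x| <= expR (- l * t) * `|x|.
Proof.
move=> lP t0; apply: (sg_decay_dense P_proj) => // {}x.
  exact: (compl_dom A_self_adjoint P_red).
move=> dx Px.
have := @energy_decay _ _ _ norm_dot A l (fun s => T s x) t t0.
rewrite sg0; apply.
- exact: sg_orbit_continuous.
- by move=> s s0; exact: sg_rderiv_op.
- move=> s s0; apply: lP; first exact: sg_dom.
  by rewrite -sg_proj// Px sgv0.
Qed.

End Reducing.

End Semigroup.

(** * Symmetry of the semigroup *)

Section Symmetry.
Context {R : realType} {H : completeNormedModType R}.
Variable dot : {dot H for idfun}.
Hypothesis norm_dot : hilbert_norm dot.
Variable A : operator H.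
Hypothesis A_self_adjoint : self_adjoint dot A.
Hypothesis A_nonneg : nonnegative dot A.
Variable T : R -> H -> H.
Hypothesis T_C0 : C0_semigroup T.
Hypothesis T_gen : generated_by_opp A T.

Let contract := sg_contract norm_dot A_self_adjoint A_nonneg T_C0 T_gen.

Lemma sg_back_dist (r h : R) x : 0 <= h -> h <= r ->
  `|T r x - T (r - h) x| <= `|x - T h x|.
Proof.
move=> h0 hr; have rh : 0 <= r - h by rewrite subr_ge0.
have -> : T r x = T (r - h) (T h x) by rewrite -(sg_add T_C0)// subrK.
by rewrite distrC -(sgB T_C0)//; exact: contract.
Qed.

(** Increasing [s] runs the orbit backwards, so the quotient is [- T (t - s - h)] applied to the
    quotient at [0]. The contraction bound controls the moving operator and gives the limit. *)
Lemma sg_rderiv_back (t s : R) y : s < t -> dom A y ->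
  rderiv (fun s => T (t - s) y) s (T (t - s) (A y)).
Proof.
move=> st dy; rewrite /rderiv.
have h0 := @sg_rderiv0 _ _ _ _ T_gen y dy.
apply/cvgrPdist_lt => e e0.
have e2 : 0 < e / 2 by rewrite divr_gt0.
have [d d0 hd] := sg_dist_small T_C0 (A y) e2.
move/cvgrPdist_lt : h0 => /(_ _ e2) h0.
near=> h.
have hp : 0 < h by near: h; exact: nbhs_right_gt.
have hr : h <= t - s by near: h; apply: nbhs_right_le; rewrite subr_gt0.
have hd' : h < d by near: h; exact: nbhs_right_lt.
have rh : 0 <= t - s - h by rewrite subr_ge0.
have h1 : `|- A y - h^-1 *: (T h y - y)| < e / 2 by near: h; exact: h0.
set w := h^-1 *: (T h y - y) in h1.
have -> : h^-1 *: (T (t - (s + h)) y - T (t - s) y) = - T (t - s - h) w.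
  rewrite /w (sgZ T_C0)// (sgB T_C0)// -(sg_add T_C0) ?(ltW hp)//.
  by rewrite subrK opprD addrA -scalerN opprB.
have -> : T (t - s) (A y) - - T (t - s - h) w =
    (T (t - s) (A y) - T (t - s - h) (A y)) - T (t - s - h) (- A y - w).
  rewrite (sgB T_C0)// (sgN T_C0)//; move: (T _ w) (T _ (A y)) => u v.
  by rewrite opprB !opprK (addrC u) addrA subrK.
apply: le_lt_trans (ler_normB _ _) _; rewrite [ltRHS]splitr; apply: ltr_leD.
  apply: le_lt_trans (hd h (ltW hp) hd'); exact: sg_back_dist (ltW hp) hr.
by apply: le_trans (contract _ rh) _; exact: ltW.
Unshelve. all: by end_near. Qed.

(* [s |-> <T s x, T (t - s) y>] is constant on [[0, t]] for [x, y] in the domain. *)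
Lemma sg_sym t x y : 0 <= t -> dot (T t x) y = dot x (T t y).
Proof.
move=> t0.
(* The monotonicity lemma yields one inequality; exchanging [u] and [z] gives the other. *)
have sym_dom u z : dom A u -> dom A z -> dot (T t u) z <= dot u (T t z).
  move=> du dz.
  have := @rderiv_le0 _ (fun s => dot (T s u) (T (t - s) z)) (fun=> 0) t t0.
  rewrite subrr subr0 !(sg0 T_C0); apply => //.
  - apply/subspace_continuousP => s Is; apply: cvg_dot => //.
      exact: within_ray_cvg (@sg_orbit_continuous _ _ _ T_C0 u) Is.
    move: (Is); rewrite /= in_itv/= => /andP[s0 st].
    apply/cvgrPdist_lt => e e0.
    have [d d0 hd] := sg_dist_small T_C0 z e0.
    rewrite near_withinE; apply/nbhs_ballP; exists d => // r; rewrite /ball/= => sr.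
    rewrite in_itv/= => /andP[r0 rt].
    have [rs|/ltW rs] := leP s r.
      have rs0 : 0 <= r - s by rewrite subr_ge0.
      apply: le_lt_trans (hd (r - s) rs0 _); last first.
        by move: sr; rewrite distrC ger0_norm.
      have -> : t - r = t - s - (r - s) by rewrite opprB addrA subrK.
      by apply: sg_back_dist => //; rewrite lerB.
    have rs0 : 0 <= s - r by rewrite subr_ge0.
    apply: le_lt_trans (hd (s - r) rs0 _); last first.
      by move: sr; rewrite ger0_norm.
    have -> : t - s = t - r - (s - r) by rewrite opprB addrA subrK.
    by rewrite distrC; apply: sg_back_dist => //; rewrite lerB.
  - move=> s s0 st.
    have := rderiv_dot norm_dot (sg_rderiv_op T_C0 T_gen s0 du)
      (sg_rderiv_back st dz).
    have ts : 0 <= t - s by rewrite subr_ge0 ltW.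
    rewrite -(sg_op T_C0 T_gen ts dz) dotNl.
    rewrite -(op_sym A_self_adjoint) ?addNr//; exact: (sg_dom T_C0 T_gen).
have sym_eq u z : dom A u -> dom A z -> dot (T t u) z = dot u (T t z).
  move=> du dz; apply/eqP; rewrite eq_le sym_dom//=.
  by rewrite dotC (dotC _ _ z) sym_dom.
have sym_eq1 u z : dom A u -> dot (T t u) z = dot u (T t z).
  move=> du; have [w dw wz] := dom_seq A_self_adjoint z.
  have h1 : (fun n => dot (T t u) (w n)) @ \oo --> dot (T t u) z by exact: cvg_dotr.
  have h2 : (fun n => dot u (T t (w n))) @ \oo --> dot u (T t z).
    apply: cvg_dotr => //; apply: continuous_cvg => //.
    exact: (sg_continuous T_C0).
  rewrite (_ : (fun n => _) = (fun n => dot u (T t (w n)))) in h1.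
    exact: (cvg_unique (@Rhausdorff R) h1 h2).
  by apply/funext => n; rewrite sym_eq.
have [w dw wx] := dom_seq A_self_adjoint x.
have h1 : (fun n => dot y (T t (w n))) @ \oo --> dot y (T t x).
  apply: cvg_dotr => //; apply: continuous_cvg => //.
  exact: (sg_continuous T_C0).
have h2 : (fun n => dot (T t y) (w n)) @ \oo --> dot (T t y) x.
  exact: cvg_dotr.
rewrite dotC (dotC _ x).
rewrite (_ : (fun n => _) = (fun n => dot (T t y) (w n))) in h1.
  exact: (cvg_unique (@Rhausdorff R) h1 h2).
by apply/funext => n; rewrite dotC sym_eq1// dotC.
Qed.

End Symmetry.

(** * Norm estimates for weak integrals *)

Section VectorIntegral.
Context {R : realType} {H : completeNormedModType R}.
Variable dot : {dot H for idfun}.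
Hypothesis norm_dot : hilbert_norm dot.

Let integrable_itv_cst (a b k : R) :
  (@lebesgue_measure R).-integrable `[a, b] (EFin \o (cst k : R -> R)).
Proof.
apply: (@continuous_compact_integrable R (cst k)); first exact: segment_compact.
by apply: continuous_subspaceT => x; exact: cvg_cst.
Qed.

Let Rintegral_itv_cst (a b k : R) : a <= b ->
  \int[@lebesgue_measure R]_(s in `[a, b]) k = k * (b - a).
Proof.
move=> ab; rewrite Rintegral_cst//; congr (k * _).
transitivity (fine (@lebesgue_measure R `[a, b]%classic)) => //.
rewrite lebesgue_measure_itv/= lte_fin.
by move: ab; rewrite le_eqVlt => /predU1P[->|->//]; rewrite ltxx subrr.
Qed.

Lemma vector_integral_dist (f : R -> H) (a b K : R) (z w : H) : a <= b ->
  0 <= K -> (forall s, a <= s <= b -> `|f s - z| <= K) ->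
  vector_integral dot f a b w -> `|w - (b - a) *: z| <= K * (b - a).
Proof.
move=> ab K0 fK fw; apply: (norm_le_dual norm_dot).
  by rewrite mulr_ge0// subr_ge0.
move=> y; have [fi fE] := fw y.
rewrite dotBl dotZl fE.
have -> : (b - a) * dot z y = \int[@lebesgue_measure R]_(s in `[a, b]) dot z y.
  by rewrite Rintegral_itv_cst// mulrC.
have -> : K * (b - a) * `|y| =
    \int[@lebesgue_measure R]_(s in `[a, b]) (K * `|y|).
  by rewrite Rintegral_itv_cst// mulrAC.
rewrite -RintegralB//; last exact: integrable_itv_cst.
apply: le_Rintegral => //; last 2 first.
- exact: integrable_itv_cst.
- move=> s; rewrite /= in_itv/= => sab; rewrite -dotBl.
  by apply: le_trans (dot_le norm_dot _ _) _; rewrite ler_wpM2r// fK.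
have mI : measurable (`[a, b]%classic : set (measurableTypeR R)).
  exact: measurable_itv.
exact: (integrableB mI fi (integrable_itv_cst a b (dot z y))).
Qed.

Lemma vector_integral_bound (f : R -> H) (a b K : R) (w : H) : a <= b ->
  0 <= K -> (forall s, a <= s <= b -> `|f s| <= K) ->
  vector_integral dot f a b w -> `|w| <= K * (b - a).
Proof.
move=> ab K0 fK fw; have := @vector_integral_dist f a b K 0 w ab K0 _ fw.
by rewrite scaler0 subr0; apply => s /fK; rewrite subr0.
Qed.

End VectorIntegral.

(** * Mild solutions *)

Section MildSolution.
Context {R : realType} {H : completeNormedModType R}.
Variable dot : {dot H for idfun}.
Hypothesis norm_dot : hilbert_norm dot.
Variable A : operator H.
Hypothesis A_self_adjoint : self_adjoint dot A.
Hypothesis A_nonneg : nonnegative dot A.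
Variable T : R -> H -> H.
Hypothesis T_C0 : C0_semigroup T.
Hypothesis T_gen : generated_by_opp A T.
Variables (F : H -> H) (M L : R).
Hypothesis M_gt0 : 0 < M.
Hypothesis L_gt0 : 0 < L.
Hypothesis F_bounded : forall u, `|F u| <= M.
Hypothesis F_lipschitz : forall u w, `|F u - F w| <= L * `|u - w|.
Variables (u0 : H) (v : R -> H).
Hypothesis v_continuous : {within `[0, +oo[%classic, continuous v}.
Hypothesis v_mild : forall t : R, 0 <= t ->
  vector_integral dot (fun s => T (t - s) (F (v s))) 0 t (v t - T t u0).

Let contract := sg_contract norm_dot A_self_adjoint A_nonneg T_C0 T_gen.
Let sym := sg_sym norm_dot A_self_adjoint A_nonneg T_C0 T_gen.

(** Subtracting [T h] applied to the Duhamel formula at [t] from the formula at [t + h] leaves the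
    integral over the last interval. The integral being weak, [T h] is transferred to the test
    vector by symmetry. *)
Lemma mild_restart (t h : R) : 0 <= t -> 0 <= h ->
  vector_integral dot (fun s => T (t + h - s) (F (v s))) t (t + h)
    (v (t + h) - T h (v t)).
Proof.
move=> t0 h0 y; have th0 : 0 <= t + h by rewrite addr_ge0.
have tth : t <= t + h by rewrite lerDl.
have [i1 e1] := v_mild th0 y; have [i2 e2] := v_mild t0 (T h y).
have mI (a b : R) : measurable (`[a, b]%classic : set (measurableTypeR R)).
  exact: measurable_itv.
have mJ : measurable (`]t, t + h]%classic : set (measurableTypeR R)).
  exact: measurable_itv.
have i3 : (@lebesgue_measure R).-integrable `[t, (t + h)]
    (fun s => (dot (T (t + h - s) (F (v s))) y)%:E).
  apply: integrableS i1 => //.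
  by move=> s /=; rewrite !in_itv/= => /andP[ts ->]; rewrite (le_trans t0 ts).
have i4 : (@lebesgue_measure R).-integrable `]t, (t + h)]
    (fun s => (dot (T (t + h - s) (F (v s))) y)%:E).
  apply: integrableS i3 => //.
  by move=> s /=; rewrite !in_itv/= => /andP[/ltW -> ->].
split => //.
(* Cutting at [t] leaves a half-open interval, which differs from the closed one by a null set. *)
rewrite -(Rintegral_itv_obnd_cbnd i4) -(Rintegral_itvB i1) ?bnd_simp//.
rewrite -e1.
have -> : \int[@lebesgue_measure R]_(s in `[0, t]) dot (T (t + h - s) (F (v s))) y
    = dot (v t - T t u0) (T h y).
  rewrite e2; apply: eq_Rintegral => s; rewrite inE/= in_itv/= => /andP[s0 st].
  by rewrite -sym// -(sg_add T_C0) ?subr_ge0// addrA (addrC h).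
rewrite -sym// (sgB T_C0)// -(sg_add T_C0)// (addrC h) !dotBl; ring.
Qed.

Lemma mild_step (t h : R) : 0 <= t -> 0 <= h ->
  `|v (t + h) - T h (v t)| <= M * h.
Proof.
move=> t0 h0; have tth : t <= t + h by rewrite lerDl.
have -> : M * h = M * (t + h - t) by rewrite addrAC subrr add0r.
apply: (vector_integral_bound norm_dot tth (ltW M_gt0)) (mild_restart t0 h0).
move=> s /andP[_ sth]; apply: le_trans (F_bounded (v s)).
by apply: contract; rewrite subr_ge0.
Qed.

Lemma mild_init : v 0 = u0.
Proof.
have := vector_integral_bound norm_dot (lexx 0) (ltW M_gt0) _ (v_mild (lexx 0)).
rewrite subrr mulr0 (sg0 T_C0) normr_le0 subr_eq0 => h; apply/eqP/h => s.
move=> /andP[s0 s0']; apply: le_trans (F_bounded (v s)).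
by apply: contract; rewrite subr_ge0.
Qed.

(** The part of the derivative that exists even when [v t] is outside [dom A]: the integrand of the
    restart formula is uniformly close to [F (v t)], by continuity of [v] and of the orbit of
    [F (v t)]. *)
Lemma mild_increment (t : R) : 0 <= t ->
  (fun h => h^-1 *: (v (t + h) - T h (v t))) @ 0^'+ --> F (v t).
Proof.
move=> t0; apply/cvgrPdist_le => e e0.
have e2 : 0 < e / 2 by rewrite divr_gt0.
have eL : 0 < e / 2 / L by rewrite divr_gt0.
have [d1 d10 hd1] := sg_dist_small T_C0 (F (v t)) e2.
have [d2 d20 hd2] : exists2 d, 0 < d &
    forall s, t <= s -> s < t + d -> `|v t - v s| < e / 2 / L.
  have tI : `[0, +oo[%classic t by rewrite /= in_itv/= andbT.
  move/subspace_continuousP : v_continuous => /(_ _ tI)/cvgrPdist_lt/(_ _ eL).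
  rewrite near_withinE => /nbhs_ballP[d /= d0 hd]; exists d => // s ts std.
  apply: hd; last by rewrite /= in_itv/= andbT (le_trans t0).
  by rewrite /ball/= distrC ger0_norm ?subr_ge0// ltrBlDl.
near=> h.
have hp : 0 < h by near: h; exact: nbhs_right_gt.
have h1 : h < d1 by near: h; exact: nbhs_right_lt.
have h2 : h < d2 by near: h; exact: nbhs_right_lt.
have tth : t <= t + h by rewrite lerDl ltW.
have bound s : t <= s <= t + h -> `|T (t + h - s) (F (v s)) - F (v t)| <= e.
  move=> /andP[ts sth]; have r0 : 0 <= t + h - s by rewrite subr_ge0.
  have -> : T (t + h - s) (F (v s)) - F (v t) =
      T (t + h - s) (F (v s) - F (v t)) - (F (v t) - T (t + h - s) (F (v t))).
    by rewrite (sgB T_C0)// opprB addrA subrK.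
  apply: le_trans (ler_normB _ _) _; rewrite [leRHS]splitr; apply: lerD.
    apply: le_trans (contract _ r0) _; apply: le_trans (F_lipschitz _ _) _.
    rewrite -ler_pdivlMl// mulrC distrC ltW// hd2//.
    by rewrite (le_lt_trans sth)// ltrD2l.
  by apply/ltW/hd1 => //; rewrite (le_lt_trans _ h1)// lerBlDl lerD2r.
have := vector_integral_dist norm_dot tth (ltW e0) bound (mild_restart t0 (ltW hp)).
rewrite (_ : t + h - t = h); last by rewrite addrAC subrr add0r.
move: (v (t + h) - _) => w hw.
have -> : F (v t) - h^-1 *: w = - (h^-1 *: (w - h *: F (v t))).
  by rewrite scalerBr scalerA mulVf ?scale1r ?opprB// gt_eqF.
by rewrite normrN normrZ gtr0_norm ?invr_gt0// ler_pdivrMl// mulrC.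
Unshelve. all: by end_near. Qed.

Section Reducing.
Variable P : H -> H.
Hypothesis P_red : reducing_projection dot A P.
Let P_proj := rp_projection P_red.

(** Since [P (v t)] is in the domain, the linear part of the increment has a limit after projection,
    and [mild_increment] supplies the nonlinear part. *)
Lemma mild_rderiv (t : R) : 0 <= t ->
  rderiv (fun s => P (v s)) t (P (F (v t)) - A (P (v t))).
Proof.
move=> t0; rewrite addrC.
have h1 := @sg_rderiv0 _ _ _ _ T_gen _ (rp_dom P_red (v t)).
have h2 : (fun h : R => P (h^-1 *: (v (t + h) - T h (v t)))) @ 0^'+ -->
    P (F (v t)).
  by apply: (cvg_proj norm_dot P_proj); exact: mild_increment.
have h3 : (fun h : R => h^-1 *: (T h (P (v t)) - P (v t)) +
    P (h^-1 *: (v (t + h) - T h (v t)))) @ 0^'+ --> - A (P (v t)) + P (F (v t)).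
  exact: cvgD.
apply: cvg_trans h3; apply: near_eq_cvg; near=> h.
have h0 : 0 <= h by apply: ltW; near: h; exact: nbhs_right_gt.
rewrite (projZ P_proj) -scalerDr (projB P_proj).
rewrite (sg_proj norm_dot A_self_adjoint A_nonneg T_C0 T_gen P_red)//.
by congr (_ *: _); rewrite addrC addrA subrK.
Unshelve. all: by end_near. Qed.

Variable l : R.
Hypothesis l_gt0 : 0 < l.
Hypothesis op_lower :
  forall x, dom A x -> P x = 0 -> l * `|x| ^+ 2 <= dot (A x) x.

Lemma mild_compl_step (t h : R) : 0 <= t -> 0 <= h ->
  `|v (t + h) - P (v (t + h))| <= expR (- l * h) * `|v t - P (v t)| + M * h.
Proof.
move=> t0 h0.
have -> : v (t + h) - P (v (t + h)) = T h (v t - P (v t)) +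
    ((v (t + h) - T h (v t)) - P (v (t + h) - T h (v t))).
  rewrite (projB P_proj) (sgB T_C0)//.
  rewrite (sg_proj norm_dot A_self_adjoint A_nonneg T_C0 T_gen P_red)//.
  move: (v (t + h)) (T h (v t)) => a b.
  by rewrite opprB [RHS]addrC addrACA subrK addrAC subrr sub0r.
apply: le_trans (ler_normD _ _) _; apply: lerD.
  apply: (sg_decay norm_dot A_self_adjoint A_nonneg T_C0 T_gen P_red) => //.
  exact: (proj_compl P_proj).
exact: le_trans (compl_contract norm_dot P_proj _) (mild_step t0 h0).
Qed.

Lemma mild_compl_bound (t : R) : 0 <= t ->
  `|v t - P (v t)| <= expR (- l * t) * `|u0 - P u0| + M / l.
Proof.
move=> t0; apply/ler_addgt0Pr => k k0.
(* The slack [k] makes the comparison strict at time [0] and absorbs the second-order error of a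
   finite step. *)
pose K s := expR (- l * s) * `|u0 - P u0| + M / l + k.
pose phi s := `|v s - P (v s)| - K s.
rewrite -subr_le0 -/(K t) -/(phi t).
have cK : continuous K.
  move=> s; apply: cvgD; last exact: cvg_cst.
  apply: cvgD; last exact: cvg_cst.
  by apply: cvgM; [exact: continuous_expRM|exact: cvg_cst].
apply: crossing => //.
- apply/subspace_continuousP => s Is; have vs := within_ray_cvg v_continuous Is.
  apply: cvgB; last by apply: cvg_within_filter; exact: cK.
  by apply: cvg_norm; apply: cvgB => //; exact: cvg_proj.
- rewrite /phi /K mild_init mulr0 expR0 mul1r -addrA opprD addrA subrr sub0r.
  by rewrite oppr_lt0 ltr_wpDl// divr_ge0// ltW.
- move=> s /andP[s0 _] /subr0_eq ps; near=> h.
  have h0 : 0 < h by near: h; exact: nbhs_right_gt.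
  (* Using [1 - expR (- l h) >= l h / (1 + l h)], a step from a touching point stays below [K] as
     soon as [M h (1 + l h) <= l h (M / l + k)], that is, [M h <= k]. *)
  have hk : h < k / M by near: h; apply: nbhs_right_lt; rewrite divr_gt0.
  rewrite /phi subr_le0; apply: le_trans (mild_compl_step (ltW s0) (ltW h0)) _.
  rewrite ps /K (mulrDr (- l)) expRD.
  have E0 := expR_gt0 (- l * h).
  have E1 : 1 + l * h <= expR (l * h) by exact: expR_ge1Dx.
  have EE : expR (- l * h) * expR (l * h) = 1.
    by rewrite mulNr expRN mulVf// gt_eqF// expR_gt0.
  have hM : h * M <= k by rewrite ltW// -ltr_pdivlMr.
  have Ml : M / l * l = M by rewrite divfK// gt_eqF.
  have m0 : 0 < M / l by rewrite divr_gt0.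
  have lh : 0 < l * h by rewrite mulr_gt0.
  move: (expR (- l * h)) (expR (l * h)) (M / l) (expR (- l * s)) `|u0 - P u0|
    E0 E1 EE Ml m0 => e f m E a E0 E1 EE Ml m0.
  have e1 : l * h <= (1 + l * h) * (1 - e).
    have : e * (1 + l * h) <= e * f by rewrite ler_wpM2l// ltW.
    by rewrite EE; lra.
  have e2 : M * h <= (1 - e) * (m + k).
    rewrite -(@ler_pM2l _ (1 + l * h)); last lra.
    have e3 : l * h * (m + k) <= (1 + l * h) * (1 - e) * (m + k).
      by rewrite ler_wpM2r//; lra.
    have e4 : l * h * (h * M) <= l * h * k by rewrite ler_wpM2l// ltW.
    have e5 : l * h * m = M * h by rewrite -Ml; ring.
    rewrite [leRHS]mulrA; apply: le_trans e3; lra.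
  lra.
Unshelve. all: by end_near. Qed.

End Reducing.

End MildSolution.

Lemma rderiv_cst {R : realType} {V : normedModType R} (t : R) (x : V) :
  rderiv (cst x) t 0.
Proof.
rewrite /rderiv (_ : (fun h : R => _) = cst 0); first exact: cvg_cst.
by apply/funext => h; rewrite subrr scaler0.
Qed.

(** * The tracking error *)

Section Tracking.
Context {R : realType} {H : completeNormedModType R}.
Variable dot : {dot H for idfun}.
Hypothesis norm_dot : hilbert_norm dot.
Variable A : operator H.
Hypothesis A_self_adjoint : self_adjoint dot A.
Variable P : H -> H.
Hypothesis P_red : reducing_projection dot A P.
Variables (F : H -> H) (L sigma : R).
Hypothesis L_gt0 : 0 < L.
Hypothesis sigma_gt0 : 0 < sigma.
Hypothesis F_lipschitz : forall u w, `|F u - F w| <= L * `|u - w|.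
Hypothesis monotone : forall p1 p2 q, P p1 = p1 -> P p2 = p2 -> P q = 0 ->
  sigma * `|p1 - p2| ^+ 2 <=
    dot (A (p1 - p2) - P (F (p1 + q) - F (p2 + q))) (p1 - p2).

Let P_proj := rp_projection P_red.

(** Insert [F (p + q)] with [q = x - P x]. Monotonicity handles the pair sharing [q], and the
    Lipschitz bound the pair sharing [p], so the forcing contains only [q - k]. *)
Lemma difference_dissipation (x p k : H) : P p = p -> P k = 0 ->
  dot ((P (F x) - A (P x)) - (P (F (p + k)) - A p)) (P x - p) <=
    - sigma * `|P x - p| ^+ 2 + L * `|x - P x - k| * `|P x - p|.
Proof.
move=> Pp Pk; set q := x - P x.
have Pq : P q = 0 by exact: (proj_compl P_proj).
have PPx := proj_idem P_proj x.
have dp : dom A p by rewrite -Pp; exact: (rp_dom P_red).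
have xE : x = P x + q by rewrite /q addrC subrK.
have lip : dot (P (F (p + q) - F (p + k))) (P x - p) <= L * `|q - k| * `|P x - p|.
  apply: le_trans (dot_le norm_dot _ _) _; rewrite ler_wpM2r//.
  apply: le_trans (proj_contract norm_dot P_proj _) _.
  apply: le_trans (F_lipschitz _ _) _.
  by rewrite opprD addrACA subrr add0r.
have := monotone PPx Pp Pq.
rewrite -xE (opB A_self_adjoint)//; last exact: (rp_dom P_red).
move: lip; rewrite !(projB P_proj); move: (P x - p) => y.
rewrite !dotBl; lra.
Qed.

Lemma tracking_estimate (v w k : R -> H) (l a d : R) :
  0 < l -> 0 <= a -> 0 <= d ->
  {within `[0, +oo[%classic, continuous v} ->
  {within `[0, +oo[%classic, continuous w} ->
  (forall t, 0 <= t -> P (w t) = w t /\ P (k t) = 0) ->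
  w 0 = P (v 0) ->
  (forall t, 0 < t -> rderiv (fun s => P (v s)) t (P (F (v t)) - A (P (v t)))) ->
  (forall t, 0 < t -> rderiv w t (P (F (w t + k t)) - A (w t))) ->
  (forall t, 0 <= t -> `|v t - P (v t) - k t| <= expR (- l * t) * a + d) ->
  forall t, 0 <= t -> `|P (v t) - w t| <= L * a / l + L / sigma * d.
Proof.
move=> l0 a0 d0 cv cw Pwk w0 dv dw vk t t0.
have [L0 lge0 sigma0] := And3 (ltW L_gt0) (ltW l0) (ltW sigma_gt0).
(* The integral of the forcing [L a expR (- l s)] over the whole half-line. *)
pose c := L * a / l; have c0 : 0 <= c by rewrite divr_ge0 ?mulr_ge0.
have Ld0 : 0 <= L / sigma * d by rewrite mulr_ge0// divr_ge0.
apply/ler_addgt0Pr => e e0.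
(* [K' = L a expR (- l s)], while [sigma K >= sigma e + L d]; hence
   [K' > - sigma K + L (a expR (- l s) + d)] strictly. *)
pose K s := e + L / sigma * d + c - c * expR (- l * s).
have E_le1 s : 0 <= s -> expR (- l * s) <= 1.
  by move=> s0; rewrite -[leRHS]expR0 ler_expR mulNr oppr_le0 mulr_ge0// ltW.
have K_ge s : 0 <= s -> e + L / sigma * d <= K s.
  move=> s0; have : c * expR (- l * s) <= c by rewrite ler_piMr// E_le1.
  by rewrite /K; lra.
have K_gt0 s : 0 <= s -> 0 < K s.
  by move=> /K_ge; apply: lt_le_trans; rewrite ltr_wpDr.
(* Squares are compared because the norm need not be differentiable at [0]. *)
pose phi s := `|P (v s) - w s| ^+ 2 - K s * K s.
suff : phi t <= 0.
  rewrite subr_le0 -expr2 ler_sqr ?nnegrE ?(ltW (K_gt0 _ t0))// => h.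
  apply: le_trans h _.
  have := expR_gt0 (- l * t); rewrite /K -/c; nra.
have cK : continuous K.
  move=> s; apply: cvgB; first exact: cvg_cst.
  by apply: cvgM; [exact: cvg_cst|exact: continuous_expRM].
apply: crossing => //.
- apply/subspace_continuousP => s Is.
  have vs := within_ray_cvg cv Is; have ws := within_ray_cvg cw Is.
  apply: cvgB; last by apply: cvg_within_filter; apply: cvgM; exact: cK.
  have Pv : (fun s => P (v s) - w s) @ within `[0, t]%classic (nbhs s) -->
      P (v s) - w s by apply: cvgB => //; exact: cvg_proj.
  rewrite (_ : (fun y => _) = (fun y => dot (P (v y) - w y) (P (v y) - w y))).
    by rewrite norm_dot; exact: cvg_dot.
  by apply/funext => y; rewrite norm_dot.
- rewrite /phi w0 subrr normr0 expr0n/= sub0r oppr_lt0.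
  by rewrite mulr_gt0// K_gt0.
- move=> s /andP[s0 _] ps; have [Pw Pk] := Pwk _ (ltW s0).
  pose E := expR (- l * s).
  have dK : rderiv K s (- (c * (- l * E))).
    have hE := @rderiv_expR R (- l) s.
    rewrite -[- (c * _)]add0r; apply: rderivB; first exact: rderiv_cst.
    have := rderivM (rderiv_cst s c) hE.
    by rewrite mul0r add0r.
  have phi0 : `|P (v s) - w s| = K s.
    move/subr0_eq : (ps); rewrite -expr2 => /eqP.
    by rewrite eqrXn2 ?(ltW (K_gt0 _ (ltW s0)))// => /eqP.
  apply: rderiv_lt0_le0 ps.
    by apply: rderivB (rderivM dK dK); apply: (norm_rderiv norm_dot);
      apply: rderivB; [exact: dv|exact: dw].
  have := difference_dissipation (v s) Pw Pk; rewrite phi0.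
  have := vk _ (ltW s0); have := K_gt0 _ (ltW s0); have := K_ge _ (ltW s0).
  move: (dot _ _) `|v s - _ - _| (K s) => D g k0; rewrite -/E => K1 K2 hg hD.
  have cl : c * l = L * a by rewrite /c divfK// gt_eqF.
  have sd : sigma * (L / sigma * d) = L * d by field; rewrite gt_eqF.
  have h1 : L * g * k0 <= L * (E * a + d) * k0.
    by rewrite ler_wpM2r ?(ltW K2)// ler_wpM2l// ltW.
  have h2 : sigma * (e + L / sigma * d) * k0 <= sigma * k0 * k0.
    by rewrite ler_wpM2r ?(ltW K2)// ler_wpM2l// ltW.
  have h3 : 0 < sigma * e * k0 by rewrite !mulr_gt0.
  have h4 : c * (- l * E) = - (L * a * E) by rewrite -cl; ring.
  rewrite h4; rewrite mulrDr sd in h2.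
  lra.
Qed.

End Tracking.

(** In the zero space the zero map is a resolvent for every [l], so the spectrum is empty and the
    infimum takes its default value. *)
Lemma bottom_trivial {R : realType} {H : completeNormedModType R}
    (dot : {dot H for idfun}) (A : operator H) (P : H -> H) :
  self_adjoint dot A -> (forall x, P x = x) ->
  inf (spectrum_on (range (fun x => x - P x)) A) = 0.
Proof.
move=> sA P1; rewrite (_ : spectrum_on _ _ = set0) ?inf0//.
have V0 x : range (fun x => x - P x) x -> x = 0.
  by move=> [y _ <-]; rewrite P1 subrr.
apply/seteqP; split => // l; apply; exists (fun=> 0); split.
- move=> y Vy; have y0 := V0 _ Vy; rewrite (op0 sA) scaler0 subr0.
  by split => //; [rewrite -y0|exact: (dom0 sA)].
- by move=> x /V0 ->.
- by exists 0 => y _; rewrite normr0 mul0r.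
Qed.

(** * The tracking estimate for the spectral splitting and the inertial manifold *)

Section TrackingError.
Context {R : realType} {H : completeNormedModType R}.
Variable dot : {dot H for idfun}.
Hypothesis norm_dot : hilbert_norm dot.
Variable A : operator H.
Hypothesis A_self_adjoint : self_adjoint dot A.
Hypothesis A_nonneg : nonnegative dot A.
Variables (F : H -> H) (M L : R).
Hypothesis M_gt0 : 0 < M.
Hypothesis L_gt0 : 0 < L.
Hypothesis F_bounded : forall u, `|F u| <= M.
Hypothesis F_lipschitz : forall u w, `|F u - F w| <= L * `|u - w|.
Variable E : set R -> H -> H.
Hypothesis E_spectral : spectral_measure dot A E.
Variable S : R -> H -> H.
Hypothesis S_semiflow : mild_semiflow dot A F S.
Variables mu eps : R.
Hypothesis mu_gt0 : 0 < mu.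
Hypothesis eps_gt0 : 0 < eps.
Hypothesis gap : 8 * L <= gamma_eps A E mu eps.
Variables (Seps : R -> H -> H) (h : H -> H).
Hypothesis h_inertial : inertial_manifold A E mu eps F M L Seps h.
Variable sigma : R.
Hypothesis sigma_gt0 : 0 < sigma.
Hypothesis monotone : forall p1 p2 q,
  range (P_eps E mu eps) p1 -> range (P_eps E mu eps) p2 ->
  range (Q_eps E mu eps) q ->
  sigma * `|p1 - p2| ^+ 2 <=
    dot (A (p1 - p2) - P_eps E mu eps (F (p1 + q) - F (p2 + q))) (p1 - p2).

Local Notation P := (P_eps E mu eps).
Local Notation lam := (lambda_eps A E mu eps).

Let cut_gt0 : 0 < mu * eps ^- 2.
Proof. by rewrite mulr_gt0// invr_gt0 exprn_gt0. Qed.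

Lemma P_eps_reducing : reducing_projection dot A P.
Proof.
have [Ep ET EI [m [mE mdom mop]]] := E_spectral.
exact: (E_reducing norm_dot A_self_adjoint Ep ET EI mE mdom mop).
Qed.

Let P_proj := rp_projection P_eps_reducing.

Lemma Q_eps_lower_bound x : dom A x -> P x = 0 ->
  mu * eps ^- 2 * `|x| ^+ 2 <= dot (A x) x.
Proof.
have [Ep ET EI [m [mE mdom mop]]] := E_spectral.
move=> dx Px.
exact: (op_lower_bound norm_dot A_nonneg Ep ET EI mE mdom mop (ltW cut_gt0) dx Px).
Qed.

Let gamma_gt0 : 0 < gamma_eps A E mu eps.
Proof. by apply: lt_le_trans gap; rewrite mulr_gt0. Qed.

Lemma c_eps_sqr :
  c_eps A E mu eps L ^+ 2 = 1 + 16 * L ^+ 2 / gamma_eps A E mu eps ^+ 2.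
Proof.
rewrite sqr_sqrtr//; apply: addr_ge0 => //; apply: divr_ge0; last exact: sqr_ge0.
by apply: mulr_ge0 => //; exact: sqr_ge0.
Qed.

(** The gap condition gives [16 L^2 / gamma^2 <= 1 / 4]; any bound free of [eps] is enough for the
    uniform estimate. *)
Lemma c_eps_le2 : c_eps A E mu eps L <= 2.
Proof.
rewrite -ler_sqr ?nnegrE ?sqrtr_ge0// c_eps_sqr -lerBrDl ler_pdivrMr ?exprn_gt0//.
have h8 : (8 * L) ^+ 2 <= gamma_eps A E mu eps ^+ 2.
  by rewrite ler_sqr ?nnegrE ?(ltW gamma_gt0)// mulr_ge0// ltW.
have := sqr_ge0 L; rewrite exprMn in h8; lra.
Qed.

Lemma graph_error (p w : H) : P p = p -> P w = w ->
  `|p + h p - (w + h w)| <= c_eps A E mu eps L * `|p - w|.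
Proof.
move=> Pp Pw; have [hQ hL _ _] := h_inertial.
have Rp : range P p by apply/(range_proj P_proj).
have Rw : range P w by apply/(range_proj P_proj).
have [/(range_compl P_proj) hp _] := hQ _ Rp.
have [/(range_compl P_proj) hw _] := hQ _ Rw.
have lip : `|h p - h w| <= 4 * L / gamma_eps A E mu eps * `|p - w|.
  exact: (hL (p, w) (conj Rp Rw)).
have -> : p + h p - (w + h w) = (p - w) + (h p - h w) by rewrite opprD addrACA.
have ort : dot (p - w) (h p - h w) = 0.
  have -> : p - w = P (p - w) by rewrite (projB P_proj) Pp Pw.
  rewrite (proj_sym P_proj).
  by rewrite (projB P_proj) hp hw subrr dot0r.
rewrite -ler_sqr ?nnegrE ?mulr_ge0 ?sqrtr_ge0//.
rewrite (orthogonal_norm norm_dot ort) exprMn c_eps_sqr.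
rewrite mulrDl mul1r lerD2l.
have -> : 16 * L ^+ 2 / gamma_eps A E mu eps ^+ 2 * `|p - w| ^+ 2 =
    (4 * L / gamma_eps A E mu eps * `|p - w|) ^+ 2.
  by rewrite !exprMn exprVn; congr (_ * _ * _ * _); rewrite -natrX.
have k0 : 0 <= 4 * L / gamma_eps A E mu eps.
  by rewrite divr_ge0 ?(ltW gamma_gt0)// mulr_ge0// ltW.
by rewrite ler_sqr ?nnegrE//; exact: mulr_ge0.
Qed.

(** The rate [l] and the sizes [a], [d] are left free so that one argument serves both [Q = 0] and
    [Q != 0]. The vector [k] stands for the value of [h] along the reduced solution. *)
Lemma tracking_error_le (u0 : H) (l a d : R) : 0 < l -> 0 <= a -> 0 <= d ->
  (forall k, P k = 0 -> `|k| <= M / alpha_eps A E mu eps -> forall t, 0 <= t ->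
    `|S t u0 - P (S t u0) - k| <= expR (- l * t) * a + d) ->
  (tracking_error E mu eps S Seps h u0 <=
    (c_eps A E mu eps L * (L * a / l + L / sigma * d))%:E)%E.
Proof.
move=> l0 a0 d0 vk; have [T [T_C0 T_gen cv v_mild]] := S_semiflow u0.
have [hQ _ _ ode] := h_inertial.
have v0 := mild_init norm_dot A_self_adjoint A_nonneg T_C0 T_gen M_gt0
  F_bounded v_mild.
have RP x : range P (P x) by exists x.
have [w [w0 cw hw dw]] := ode _ (RP u0).
have Pw t : 0 <= t -> P (w t) = w t.
  by move=> /hw[/(range_proj P_proj)].
have Pk t : 0 <= t -> P (h (w t)) = 0.
  by move=> t0; have [/(range_compl P_proj)] := hQ _ (hw _ t0).1.
apply: ge_ereal_sup => _ [t /= t0 <-]; rewrite lee_fin.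
rewrite /R_eps (hw _ t0).2.
apply: le_trans (graph_error (proj_idem P_proj _) (Pw _ t0)) _.
rewrite ler_wpM2l ?sqrtr_ge0//.
apply: (@tracking_estimate _ _ _ norm_dot A A_self_adjoint P P_eps_reducing F L sigma
  L_gt0 sigma_gt0 F_lipschitz _ (S ^~ u0) w (h \o w)) => //.
- move=> p1 p2 q P1 P2 Pq; apply: monotone; [| |exact/(range_compl P_proj)].
  + exact/(range_proj P_proj).
  + exact/(range_proj P_proj).
- by move=> s s0; split; [exact: Pw|exact: Pk].
- by rewrite w0 v0.
- move=> s s0; exact: (mild_rderiv norm_dot A_self_adjoint A_nonneg T_C0 T_gen
    L_gt0 F_lipschitz cv v_mild P_eps_reducing (ltW s0)).
- by move=> s s0; apply: is_derive_rderiv; exact: dw.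
- by move=> s s0; apply: vk => //; [exact: Pk|exact: (hQ _ (hw _ s0).1).2].
Qed.

(** Both complementary components vanish, so [a = d = 0] and any positive rate works. The rate [1]
    replaces [lambda_eps], which is [0] here. *)
Lemma tracking_error_trivial (u0 : H) : (forall x, P x = x) ->
  (tracking_error E mu eps S Seps h u0 <= 0)%E.
Proof.
move=> P1.
have := @tracking_error_le u0 1 0 0 ltr01 (lexx _) (lexx _).
rewrite !mulr0 mul0r addr0 mulr0; apply => k Pk _ t _.
by rewrite P1 subrr -(P1 k) Pk subr0 normr0 mulr0 addr0.
Qed.

Lemma alpha_eps_gt0 : 0 <= lam -> 0 < alpha_eps A E mu eps.
Proof. by move=> l0; rewrite ltr_wpDl// invr_gt0. Qed.

Section Nontrivial.
Hypothesis P_neq1 : exists x, P x != x.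

(** The source of the power of [eps]: both [1 / lambda_eps] and [1 / alpha_eps] are at most
    [eps ^+ 2 / mu]. *)
Lemma lambda_eps_ge : mu * eps ^- 2 <= lam.
Proof.
exact: (bottom_ge norm_dot A_self_adjoint P_eps_reducing Q_eps_lower_bound P_neq1).
Qed.

Lemma lambda_eps_gt0 : 0 < lam.
Proof. exact: lt_le_trans lambda_eps_ge. Qed.

(** The two terms of [d_eps] are the residual [M / lambda_eps] of the complementary part of the
    solution and the bound [M / alpha_eps] on the manifold's graph. *)
Lemma tracking_error_nontrivial (u0 : H) :
  (tracking_error E mu eps S Seps h u0 <=
    (c_eps A E mu eps L * (L / lam * `|Q_eps E mu eps u0|
      + L / sigma * d_eps A E mu eps M))%:E)%E.
Proof.
have l0 := lambda_eps_gt0; have a0 := alpha_eps_gt0 (ltW l0).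
have [T [T_C0 T_gen cv v_mild]] := S_semiflow u0.
rewrite mulrAC; apply: tracking_error_le => //.
  by rewrite addr_ge0// divr_ge0// ltW.
move=> k Pk kM t t0; apply: le_trans (ler_normB _ _) _.
rewrite addrA; apply: lerD => //.
apply: (mild_compl_bound norm_dot A_self_adjoint A_nonneg T_C0 T_gen M_gt0
  F_bounded cv v_mild P_eps_reducing) => // x.
exact: (bottom_le norm_dot A_self_adjoint P_eps_reducing Q_eps_lower_bound P_neq1).
Qed.

(** The outer [2] bounds [c_eps], and the inner one counts the two terms of [d_eps]. *)
Lemma tracking_bound_le (u0 : H) (r : R) : `|u0| <= r ->
  c_eps A E mu eps L * (L / lam * `|Q_eps E mu eps u0|
      + L / sigma * d_eps A E mu eps M) <=
  2 * (L / mu * r + L / sigma * (2 * M / mu)) * eps ^+ 2.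
Proof.
move=> ur; have l0 := lambda_eps_gt0.
have e2 : 0 < eps ^+ 2 by rewrite exprn_gt0.
have li : lam^-1 <= eps ^+ 2 / mu.
  rewrite -[leRHS]invrK invf_div lef_pV2 ?posrE ?divr_gt0//.
  exact: lambda_eps_ge.
have ai : (alpha_eps A E mu eps)^-1 <= lam^-1.
  by rewrite lef_pV2 ?posrE ?alpha_eps_gt0 ?(ltW l0)// lerDl invr_ge0 ltW.
have Qu : `|Q_eps E mu eps u0| <= r.
  exact: le_trans (compl_contract norm_dot P_proj u0) ur.
have r0 : 0 <= r by apply: le_trans ur.
have d_le : d_eps A E mu eps M <= 2 * M / mu * eps ^+ 2.
  have h1 : M / lam <= M * (eps ^+ 2 / mu) by rewrite ler_wpM2l// ltW.
  have h2 : M / alpha_eps A E mu eps <= M * (eps ^+ 2 / mu).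
    by rewrite ler_wpM2l ?(ltW M_gt0)// (le_trans ai).
  have -> : 2 * M / mu * eps ^+ 2 =
      M * (eps ^+ 2 / mu) + M * (eps ^+ 2 / mu) by ring.
  exact: lerD.
have Ls : 0 <= L / sigma by rewrite divr_ge0// ltW.
have Ll : 0 <= L / lam by rewrite divr_ge0// ltW.
have d_ge0 : 0 <= d_eps A E mu eps M.
  by rewrite addr_ge0// divr_ge0 ?(ltW M_gt0)// ltW// alpha_eps_gt0// ltW.
rewrite -[leRHS]mulrA; apply: ler_pM.
- exact: sqrtr_ge0.
- by apply: addr_ge0; exact: mulr_ge0.
- exact: c_eps_le2.
- rewrite mulrDl; apply: lerD.
    rewrite (_ : L / mu * r * eps ^+ 2 = L * (eps ^+ 2 / mu) * r); last by ring.
    by apply: ler_pM => //; rewrite ler_wpM2l// ltW.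
  by rewrite -[leRHS]mulrA ler_wpM2l.
Qed.

End Nontrivial.

End TrackingError.

Theorem theorem4p12 (R : realType) (H : completeNormedModType R)
    (dot : {dot H for idfun}) (A : operator H) (F : H -> H) (M L mu : R)
    (E : set R -> H -> H)
    (S : R -> H -> H) (Seps : R -> R -> H -> H) (h : R -> H -> H)
    (norm_dot : hilbert_norm dot)
    (H_infinite_dim : infinite_dimensional H)
    (A_self_adjoint : self_adjoint dot A)
    (A_nonneg : nonnegative dot A)
    (A_compact_resolvent : compact_resolvent A)
    (M_gt0 : 0 < M) (L_gt0 : 0 < L) (mu_gt0 : 0 < mu)
    (F_bounded : forall u, `|F u| <= M)
    (F_lipschitz : forall u w, `|F u - F w| <= L * `|u - w|)
    (E_spectral : spectral_measure dot A E)
    (S_semiflow : mild_semiflow dot A F S)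
    (Seps_semiflow : forall eps : R, 0 < eps <= 1 ->
       mild_semiflow dot (A_eps A E mu eps) F (Seps eps))
    (h_inertial : forall eps : R, 0 < eps <= 1 -> 8 * L <= gamma_eps A E mu eps ->
       inertial_manifold A E mu eps F M L (Seps eps) (h eps))
    (eps0 sigma : R)
    (eps0_bounds : 0 < eps0 <= 1) (sigma_gt0 : 0 < sigma)
    (monotone : forall eps : R, 0 < eps <= eps0 ->
       forall p1 p2 q, range (P_eps E mu eps) p1 -> range (P_eps E mu eps) p2 ->
         range (Q_eps E mu eps) q ->
         dot (A (p1 - p2) - P_eps E mu eps (F (p1 + q) - F (p2 + q))) (p1 - p2)
           >= sigma * `|p1 - p2| ^+ 2) :
  (forall eps : R, 0 < eps <= eps0 -> 8 * L <= gamma_eps A E mu eps ->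
     forall u0 : H,
       (tracking_error E mu eps S (Seps eps) (h eps) u0
        <= (c_eps A E mu eps L *
             (L / lambda_eps A E mu eps * `|Q_eps E mu eps u0|
              + L / sigma * d_eps A E mu eps M))%R%:E)%E) /\
  (forall B : set H, bounded_set B ->
     exists C_B : R,
       forall eps : R, 0 < eps <= eps0 -> 8 * L <= gamma_eps A E mu eps ->
         (ereal_sup [set tracking_error E mu eps S (Seps eps) (h eps) u0
                    | u0 in B]
          <= (C_B * eps ^+ 2)%R%:E)%E).
Proof.
have lam_ge0 eps : 0 < eps -> 0 <= lambda_eps A E mu eps.
  move=> eps_gt0.
  have [P1|/existsNP[x /eqP Px]] := pselect (forall x, P_eps E mu eps x = x).
    by rewrite /lambda_eps (bottom_trivial A_self_adjoint P1).
  apply: ltW; apply: (lambda_eps_gt0 norm_dot A_self_adjoint A_nonneg E_spectral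
    mu_gt0 eps_gt0).
  by exists x.
have trivial_or eps u0 : 0 < eps <= eps0 -> 8 * L <= gamma_eps A E mu eps ->
    (tracking_error E mu eps S (Seps eps) (h eps) u0 <= 0)%E \/
    ((exists x, P_eps E mu eps x != x) /\
     (tracking_error E mu eps S (Seps eps) (h eps) u0
        <= (c_eps A E mu eps L *
             (L / lambda_eps A E mu eps * `|Q_eps E mu eps u0|
              + L / sigma * d_eps A E mu eps M))%R%:E)%E).
  move=> /andP[eps_gt0 eps_le] gap.
  have hi : inertial_manifold A E mu eps F M L (Seps eps) (h eps).
    apply: h_inertial => //; rewrite eps_gt0 (le_trans eps_le)//.
    by case/andP: eps0_bounds.
  have mono := monotone eps; rewrite eps_gt0 eps_le in mono.
  have [P1|/existsNP[x /eqP Px]] := pselect (forall x, P_eps E mu eps x = x).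
    left; exact: (tracking_error_trivial norm_dot A_self_adjoint A_nonneg M_gt0
      L_gt0 F_bounded F_lipschitz E_spectral S_semiflow gap hi
      sigma_gt0 (mono isT) u0 P1).
  have P_neq1 : exists x, P_eps E mu eps x != x by exists x.
  right; split => //; exact: (tracking_error_nontrivial norm_dot A_self_adjoint
    A_nonneg M_gt0 L_gt0 F_bounded F_lipschitz E_spectral S_semiflow mu_gt0
    eps_gt0 gap hi sigma_gt0 (mono isT) P_neq1 u0).
split=> [eps heps gap u0|B [N [_ hN]]].
  have [h0|[_]//] := trivial_or eps u0 heps gap.
  (* It remains to see that the bound is nonnegative. If [lambda_eps = 0], the quotients by it are
     [0] by the convention for inverses. *)
  apply: le_trans h0 _; rewrite lee_fin.
  have /andP[eps_gt0 _] := heps; have l0 := lam_ge0 _ eps_gt0.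
  have a0 := ltW (alpha_eps_gt0 eps_gt0 l0).
  have [L0 M0 s0] := And3 (ltW L_gt0) (ltW M_gt0) (ltW sigma_gt0).
  apply: mulr_ge0; first exact: sqrtr_ge0.
  apply: addr_ge0; apply: mulr_ge0 => //; try exact: divr_ge0.
  by apply: addr_ge0; exact: divr_ge0.
(* [bounded_set] bounds by every number above [N], not by [N] itself. When [B] is empty [r] may be
   negative, hence the maximum with [0] in the constant. *)
pose r := N + 1; have Br u : B u -> `|u| <= r.
  by move=> Bu; apply: (hN r _ u Bu); rewrite ltrDl.
have r0 : 0 <= Num.max r 0 by rewrite le_max lexx orbT.
exists (2 * (L / mu * Num.max r 0 + L / sigma * (2 * M / mu))) => eps heps gap.
apply: ge_ereal_sup => _ [u0 Bu0 <-].
have /andP[eps_gt0 _] := heps.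
have [h0|[P_neq1 h1]] := trivial_or eps u0 heps gap.
  apply: le_trans h0 _; rewrite lee_fin.
  have [L0 M0 m0 s0] := And4 (ltW L_gt0) (ltW M_gt0) (ltW mu_gt0) (ltW sigma_gt0).
  apply: mulr_ge0; last exact: sqr_ge0.
  apply: mulr_ge0 => //; apply: addr_ge0; apply: mulr_ge0 => //; try exact: divr_ge0.
  by apply: divr_ge0 => //; exact: mulr_ge0.
apply: le_trans h1 _; rewrite lee_fin.
apply: (tracking_bound_le norm_dot A_self_adjoint A_nonneg M_gt0 L_gt0 E_spectral
  mu_gt0 eps_gt0 gap sigma_gt0 P_neq1).
by rewrite le_max; apply/orP; left; exact: Br.
Qed.
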